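(* Let $G$ be a discrete countable group, $\varphi:G\to G$ an injective endomorphism with infinite cokernel, and $B$ a set of subgroups of $G$ containing $G$. Let $S=G\rtimes_\varphi\mathbb{N}$ act on $D[\varphi,B]$ by $\alpha_{(g,n)}(x)=u_gs^nx{s^*}^nu_{g^{-1}}$, and let $(\overline D[\varphi,B],\overline S,\overline\alpha)$ with $\iota:D[\varphi,B]\to\overline D[\varphi,B]$ be the minimal automorphic dilation of $(D[\varphi,B],S,\alpha)$. Then there exists an isomorphism $$\Phi:\mathbb{U}[\varphi,B]\cong D[\varphi,B]\rtimes_\alpha S\cong\iota(1)\big(\overline D[\varphi,B]\rtimes_{\overline\alpha}\overline S\big)\iota(1).$$
   Context: $\mathbb{N}=\{0,1,2,\dots\}$. Infinite cokernel means that the set of left cosets $G/\varphi(G)$ is infinite. $C(B)$ is the smallest collection of subsets of $G$ that contains $B$ and is closed under finite unions, finite intersections, complements in $G$, images $X\mapsto\varphi(X)$ and left translations $X\mapsto gX$ ($g\in G$). $\mathbb{U}[\varphi,B]$ is the universal C$^*$-algebra generated by projections $\{e_{[X]}:X\in C(B)\}$, unitaries $\{u_g:g\in G\}$ and one isometry $s$ subject to, for all $g,h\in G$, $n,m\in\mathbb{N}$, $X,Y\in C(B)$: (i) $u_gs^nu_hs^m=u_{g\varphi^n(h)}s^{n+m}$; (ii) $u_gs^ne_{[X]}{s^*}^nu_{g^{-1}}=e_{[g\varphi^n(X)]}$; (iii) $e_{[G]}=1$ and $e_{[\emptyset]}=0$; (iv) $e_{[X]}e_{[Y]}=e_{[X\cap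 Y]}$; (v) $e_{[X]}+e_{[Y]}=e_{[X\cup Y]}+e_{[X\cap Y]}$. $D[\varphi,B]$ is the commutative C$^*$-subalgebra of $\mathbb{U}[\varphi,B]$ generated by $\{u_gs^ne_{[H]}{s^*}^nu_{g^{-1}}:g\in G,n\in\mathbb{N},H\in B\}$. $S=G\rtimes_\varphi\mathbb{N}$ is $G\times\mathbb{N}$ with product $(g,n)(h,m)=(g\varphi^n(h),n+m)$. The semigroup crossed product $D\rtimes_\alpha S$ is the universal unital C$^*$-algebra generated by a unital $*$-homomorphic image $\iota_D(D)$ and isometries $\iota_S(p)$, $p\in S$, with $\iota_S$ multiplicative and $\iota_S(p)\iota_D(x)\iota_S(p)^*=\iota_D(\alpha_p(x))$. $\overline S=\mathbb{G}\rtimes_{\overline\varphi}\mathbb{Z}$, where $\mathbb{G}=\varinjlim(G\xrightarrow{\varphi}G\xrightarrow{\varphi}\cdots)$ and $\overline\varphi$ is the automorphism of $\mathbb{G}$ induced by $\varphi$; $S$ embeds in $\overline S$ via the embedding of $G$ in $\mathbb{G}$ as first term, and $\overline S=S^{-1}S$. Minimal automorphic dilation: $S$ is directed by $p<q$ iff $q\in Sp$. $\overline D[\varphi,B]$ is the inductive limit over $S$ of copies $D[\varphi,B]_{p}=D[\varphi,B]$ ($p\in S$) with connecting maps $D[\varphi,B]_{p}\to D[\varphi,B]_{qp}$ given by $\alpha_q$; $\iota$ is the canonical map of $D[\varphi,B]=D[\varphi,B]_{(e,0)}$ into the limit; and $\overline\alpha$ is the action of $\overline S$ by automorphisms on $\overline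 D[\varphi,B]$ satisfying $\overline\alpha_p\circ\iota=\iota\circ\alpha_p$ for all $p\in S$, with $\bigcup_{p\in S}\overline\alpha_p^{-1}(\iota(D[\varphi,B]))$ dense in $\overline D[\varphi,B]$. $\overline D[\varphi,B]\rtimes_{\overline\alpha}\overline S$ is the (full) group crossed product. *)

(* Defs.v *)
From HB Require Import structures.
From mathcomp Require Import all_boot all_order all_algebra.
From mathcomp Require Import generic_quotient.
From mathcomp Require Import complex.
From mathcomp Require Import all_classical all_reals.
From mathcomp Require Import topology normedtype.
From mathcomp Require Import zify.

Set Implicit Arguments.
Unset Strict Implicit.
Unset Printing Implicit Defensive.

Import Order.TTheory GRing.Theory Num.Theory.
Import numFieldNormedType.Exports.

Local Open Scope classical_set_scope.
Local Open Scope ring_scope.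

(* Not necessarily unital, hence a separate product [cmul] on a complex Banach
   space rather than a MathComp ring structure.  The norm takes its values in
   the nonnegative reals of [R[i]]. *)
HB.mixin Record isCstarAlgebra (R : realType) A
    of CompleteNormedModule R[i] A := {
  cmul : A -> A -> A;
  adj : A -> A;
  cmulA : associative cmul;
  cmulDl : left_distributive cmul +%R;
  cmulDr : right_distributive cmul +%R;
  cmulZl : forall (a : R[i]) x y, cmul (a *: x) y = a *: cmul x y;
  cmulZr : forall (a : R[i]) x y, cmul x (a *: y) = a *: cmul x y;
  normcM : forall x y, `|cmul x y| <= `|x| * `|y|;
  adjK : involutive adj;
  adjD : {morph adj : x y / x + y};
  adjZ : forall (a : R[i]) x, adj (a *: x) = (a^*)%R *: adj x;
  adjM : forall x y, adj (cmul x y) = cmul (adj y) (adj x);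
  cstar_identity : forall x, `|cmul (adj x) x| = `|x| ^+ 2
}.

#[short(type="cstarAlgType")]
HB.structure Definition CstarAlgebra (R : realType) :=
  {A of isCstarAlgebra R A & CompleteNormedModule R[i] A}.

HB.mixin Record hasCstarUnit (R : realType) A of CstarAlgebra R A := {
  cone : A;
  cmul1 : left_id cone cmul;
  cmulr1 : right_id cone cmul
}.

#[short(type="unitalCstarAlgType")]
HB.structure Definition UnitalCstarAlgebra (R : realType) :=
  {A of hasCstarUnit R A & CstarAlgebra R A}.

Declare Scope cstar_scope.
Delimit Scope cstar_scope with cstar.
Notation "x * y" := (cmul x y) : cstar_scope.
Notation "x ^*" := (adj x) : cstar_scope.
Notation "1" := cone : cstar_scope.
Notation "x ^+ n" := (iter n (cmul x) cone) : cstar_scope.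

Section CstarNotions.
Context {R : realType}.
Local Open Scope cstar_scope.

Definition star_hom (A B : cstarAlgType R) (f : A -> B) : Prop :=
  [/\ linear f, {morph f : x y / x * y} & {morph f : x / x^*}].

(* [f] is a *-isomorphism of [A] onto the subset [E] of [B]. *)
Definition star_iso_onto (A B : cstarAlgType R) (f : A -> B) (E : set B) :
    Prop :=
  star_hom f /\ set_bij [set: A] E f.

Definition cstar_subalgebra (A : cstarAlgType R) (E : set A) : Prop :=
  closed E /\
  [/\ E 0, forall x y, E x -> E y -> E (x + y)%R,
      forall (a : R[i]) x, E x -> E (a *: x),
      forall x y, E x -> E y -> E (x * y) & forall x, E x -> E (x^*)].

Definition cstar_generated (A : cstarAlgType R) (X : set A) : set A :=
  smallest (@cstar_subalgebra A) X.

Definition corner (A : cstarAlgType R) (q : A) : set A :=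
  [set q * x * q | x in [set: A]].

Definition projection (A : cstarAlgType R) (x : A) : Prop :=
  x * x = x /\ x^* = x.

Definition isometry (A : unitalCstarAlgType R) (x : A) : Prop := x^* * x = 1.

Definition unitary (A : unitalCstarAlgType R) (x : A) : Prop :=
  x^* * x = 1 /\ x * x^* = 1.

End CstarNotions.

Definition subgroup (G : groupType) (H : set G) : Prop :=
  [/\ H 1%g, forall x y, H x -> H y -> H (x * y)%g
    & forall x, H x -> H (x^-1)%g].

Definition left_cosets (G : groupType) (H : set G) : set (set G) :=
  [set [set (g * h)%g | h in H] | g in [set: G]].

(* [phi] is a parameter of the type because the product depends on it. *)
Definition semidirect_nat (G : groupType) (phi : {multiplicative G -> G}) :
  Type := (G * nat)%type.

Section Semidirect.
Variables (G : groupType) (phi : {multiplicative G -> G}).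
Local Open Scope group_scope.

Definition endo_pow (n : nat) (g : G) : G := iter n (phi : G -> G) g.

Lemma endo_powM n : {morph endo_pow n : x y / x * y}.
Proof.
elim: n => // n IH x y; rewrite /endo_pow !iterS -!/(endo_pow n _) IH.
exact: gmulfM.
Qed.

Lemma endo_pow1 n : endo_pow n 1 = 1.
Proof. by apply: (mulgI (endo_pow n 1)); rewrite -endo_powM !mulg1. Qed.

Lemma endo_powV n x : endo_pow n x^-1 = (endo_pow n x)^-1.
Proof. by apply: (mulgI (endo_pow n x)); rewrite -endo_powM !mulgV endo_pow1. Qed.

Lemma endo_powD n m x : endo_pow (n + m) x = endo_pow n (endo_pow m x).
Proof. exact: iterD. Qed.

HB.instance Definition _ := Choice.on (semidirect_nat phi).

Definition sdn_mul (x y : semidirect_nat phi) : semidirect_nat phi :=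
  (x.1 * endo_pow x.2 y.1, (x.2 + y.2)%N).
Definition sdn_one : semidirect_nat phi := (1, 0%N).

Lemma sdn_mulA : associative sdn_mul.
Proof.
by case=> [g n] [h m] [k l]; rewrite /sdn_mul /= endo_powM mulgA endo_powD addnA.
Qed.
Lemma sdn_mul1 : left_id sdn_one sdn_mul.
Proof. by case=> g n; rewrite /sdn_mul /= mul1g. Qed.
Lemma sdn_mulr1 : right_id sdn_one sdn_mul.
Proof. by case=> g n; rewrite /sdn_mul /= endo_pow1 mulg1 addn0. Qed.

HB.instance Definition _ :=
  isMonoid.Build (semidirect_nat phi) sdn_mulA sdn_mul1 sdn_mulr1.

(* The limit of [G -> G -> ...] along [phi]: the class of [(g, n)] is the image
   of [g] sitting in the [n]-th copy of [G], so [(g, n)] and [(h, m)] agree when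
   they have the same image in some copy of index [k + n + m]. *)
Definition lim_eq (x y : G * nat) : bool :=
  `[< exists k, endo_pow (k + y.2) x.1 = endo_pow (k + x.2) y.1 >].

Lemma lim_eq_refl : reflexive lim_eq.
Proof. by move=> x; apply/asboolP; exists 0%N. Qed.
Lemma lim_eq_sym : symmetric lim_eq.
Proof. by move=> x y; apply/asboolP/asboolP => -[k H]; exists k. Qed.
Lemma lim_eq_trans : transitive lim_eq.
Proof.
move=> [h m] [g n] [k l] /asboolP[a /= Ha] /asboolP[b /= Hb].
apply/asboolP; exists (a + b + m)%N => /=.
rewrite (_ : a + b + m + l = (b + l) + (a + m))%N; last by lia.
rewrite endo_powD Ha -endo_powD (_ : b + l + (a + n) = (a + n) + (b + l))%N; last by lia.
rewrite endo_powD Hb -endo_powD; congr endo_pow; lia.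
Qed.

Canonical lim_eqv := EquivRel lim_eq lim_eq_refl lim_eq_sym lim_eq_trans.

Definition group_lim : Type := {eq_quot lim_eqv}%qT.
HB.instance Definition _ := Choice.on group_lim.
HB.instance Definition _ := EqQuotient.on group_lim.

Definition to_lim (n : nat) (g : G) : group_lim :=
  (\pi_(group_lim) (g, n))%qT.

Lemma to_limP n g m h :
  to_lim n g = to_lim m h <->
  exists k, endo_pow (k + m) g = endo_pow (k + n) h.
Proof. by split=> [/eqmodP/asboolP|H]; [|apply/eqmodP/asboolP]. Qed.

Lemma to_limS n k g : to_lim (k + n) (endo_pow k g) = to_lim n g.
Proof. by apply/to_limP; exists 0%N; rewrite -endo_powD; congr endo_pow; lia. Qed.

Lemma to_lim_surj (x : group_lim) : exists n g, x = to_lim n g.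
Proof. by elim/quotW: x => -[g n]; exists n, g. Qed.

Definition lim_one : group_lim := to_lim 0 1.
Definition lim_mul (x y : group_lim) : group_lim :=
  to_lim ((repr x).2 + (repr y).2)
    (endo_pow (repr y).2 (repr x).1 * endo_pow (repr x).2 (repr y).1).
Definition lim_inv (x : group_lim) : group_lim :=
  to_lim (repr x).2 (repr x).1^-1.

Lemma reprE (x : group_lim) : to_lim (repr x).2 (repr x).1 = x.
Proof. by rewrite /to_lim -surjective_pairing reprK. Qed.

Lemma lim_mulE n g h : lim_mul (to_lim n g) (to_lim n h) = to_lim n (g * h).
Proof.
rewrite /lim_mul; set x := to_lim n g; set y := to_lim n h.
have /to_limP[a Ha] := reprE x; have /to_limP[b Hb] := reprE y.
move: (repr x) (repr y) Ha Hb => [g' p] [h' q] /= Ha Hb.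
apply/to_limP; exists (a + b)%N; rewrite !endo_powM -!endo_powD; congr (_ * _).
  rewrite (_ : a + b + n + q = (b + q) + (a + n))%N; last by lia.
  by rewrite endo_powD Ha -endo_powD; congr endo_pow; lia.
rewrite (_ : a + b + n + p = (a + p) + (b + n))%N; last by lia.
by rewrite endo_powD Hb -endo_powD; congr endo_pow; lia.
Qed.

Lemma lim_invE n g : lim_inv (to_lim n g) = to_lim n g^-1.
Proof.
rewrite /lim_inv; set x := to_lim n g; have /to_limP[a Ha] := reprE x.
by apply/to_limP; exists a; rewrite !endo_powV Ha.
Qed.

Lemma lim_oneE n : lim_one = to_lim n 1.
Proof. by rewrite /lim_one -(to_limS 0 n) addn0 endo_pow1. Qed.

Lemma to_lim2 (x y : group_lim) :
  exists n g h, x = to_lim n g /\ y = to_lim n h.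
Proof.
have [n [g ->]] := to_lim_surj x; have [m [h ->]] := to_lim_surj y.
exists (n + m)%N, (endo_pow m g), (endo_pow n h).
by split; [rewrite addnC|]; rewrite to_limS.
Qed.

Lemma lim_mulA : associative lim_mul.
Proof.
move=> x y z; have [n [g [h [-> ->]]]] := to_lim2 x y.
have [m [k ->]] := to_lim_surj z.
rewrite -(to_limS n m g) -(to_limS n m h) -(to_limS m n k) (addnC n m).
by rewrite !lim_mulE mulgA.
Qed.
Lemma lim_mul1 : left_id lim_one lim_mul.
Proof.
by move=> x; have [n [g ->]] := to_lim_surj x; rewrite (lim_oneE n) lim_mulE mul1g.
Qed.
Lemma lim_mulr1 : right_id lim_one lim_mul.
Proof.
by move=> x; have [n [g ->]] := to_lim_surj x; rewrite (lim_oneE n) lim_mulE mulg1.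
Qed.
Lemma lim_mulV : left_inverse lim_one lim_inv lim_mul.
Proof.
move=> x; have [n [g ->]] := to_lim_surj x.
by rewrite lim_invE lim_mulE mulVg -lim_oneE.
Qed.
Lemma lim_mulrV : right_inverse lim_one lim_inv lim_mul.
Proof.
move=> x; have [n [g ->]] := to_lim_surj x.
by rewrite lim_invE lim_mulE mulgV -lim_oneE.
Qed.

HB.instance Definition _ := isGroup.Build group_lim
  lim_mulA lim_mul1 lim_mulr1 lim_mulV lim_mulrV.

Lemma to_limM n : {morph to_lim n : x y / x * y}.
Proof. by move=> x y; rewrite -lim_mulE. Qed.

(* The automorphism of [group_lim] induced by [phi] and its inverse, which moves
   an element to the next copy of [G]. *)
Definition lim_phi (x : group_lim) : group_lim :=
  to_lim (repr x).2 (phi (repr x).1).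
Definition lim_phiV (x : group_lim) : group_lim :=
  to_lim (repr x).2.+1 (repr x).1.

Lemma lim_phiE n g : lim_phi (to_lim n g) = to_lim n (phi g).
Proof.
rewrite /lim_phi; set x := to_lim n g; have /to_limP[a Ha] := reprE x.
by apply/to_limP; exists a; rewrite /endo_pow -!iterSr !iterS; congr (phi _).
Qed.

Lemma lim_phiVE n g : lim_phiV (to_lim n g) = to_lim n.+1 g.
Proof.
rewrite /lim_phiV; set x := to_lim n g; have /to_limP[a Ha] := reprE x.
by apply/to_limP; exists a; rewrite !addnS /endo_pow !iterS; congr (phi _).
Qed.

Lemma lim_phiK : cancel lim_phi lim_phiV.
Proof.
move=> x; have [n [g ->]] := to_lim_surj x.
by rewrite lim_phiE lim_phiVE; apply: (to_limS n 1 g).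
Qed.
Lemma lim_phiVK : cancel lim_phiV lim_phi.
Proof.
move=> x; have [n [g ->]] := to_lim_surj x.
by rewrite lim_phiVE lim_phiE; apply: (to_limS n 1 g).
Qed.

Lemma lim_phiM : {morph lim_phi : x y / x * y}.
Proof.
move=> x y; have [n [g [h [-> ->]]]] := to_lim2 x y.
by rewrite -to_limM !lim_phiE gmulfM to_limM.
Qed.
Lemma lim_phiVM : {morph lim_phiV : x y / x * y}.
Proof.
move=> x y; have [n [g [h [-> ->]]]] := to_lim2 x y.
by rewrite -to_limM !lim_phiVE to_limM.
Qed.

Definition lim_phiz (z : int) (x : group_lim) : group_lim :=
  match z with
  | Posz n => iter n lim_phi x
  | Negz n => iter n.+1 lim_phiV x
  end.

Lemma lim_phizM z : {morph lim_phiz z : x y / x * y}.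
Proof.
case: z => n; rewrite /lim_phiz.
  by elim: n => // n IH x y; rewrite !iterS IH lim_phiM.
elim: n.+1 => // {}n IH x y; rewrite !iterS IH; exact: lim_phiVM.
Qed.

Lemma lim_phizS z x : lim_phiz (1 + z)%R x = lim_phi (lim_phiz z x).
Proof.
case: z => [n|[|n]]; first by [].
  by rewrite /= lim_phiVK.
rewrite (_ : (1 + Negz n.+1)%R = Negz n); last by lia.
by rewrite [lim_phiz (Negz n.+1) x]iterS lim_phiVK.
Qed.

Lemma lim_phizP z x : lim_phiz (z - 1)%R x = lim_phiV (lim_phiz z x).
Proof.
by rewrite -[in RHS](subrK 1%R z) (addrC (z - 1)%R) lim_phizS lim_phiK.
Qed.

Lemma lim_phizD z w x : lim_phiz (z + w)%R x = lim_phiz z (lim_phiz w x).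
Proof.
elim/int_ind: z => [|n IH|n IH]; first by rewrite add0r.
  by rewrite -[n.+1%:Z]/((1 + n)%N%:Z) PoszD -addrA !lim_phizS IH.
rewrite (_ : (- n.+1%:Z)%R = (- n%:Z - 1)%R); last by lia.
by rewrite addrAC !lim_phizP IH.
Qed.

Lemma lim_phiz1 z : lim_phiz z 1 = 1.
Proof. by apply: (mulgI (lim_phiz z 1)); rewrite -lim_phizM !mulg1. Qed.

Definition semidirect_int : Type := (group_lim * int)%type.
HB.instance Definition _ := Choice.on semidirect_int.

Definition sdz_mul (x y : semidirect_int) : semidirect_int :=
  (x.1 * lim_phiz x.2 y.1, (x.2 + y.2)%R).
Definition sdz_one : semidirect_int := (1, 0%R).
Definition sdz_inv (x : semidirect_int) : semidirect_int :=
  (lim_phiz (- x.2)%R x.1^-1, (- x.2)%R).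

Lemma sdz_mulA : associative sdz_mul.
Proof.
case=> [g n] [h m] [k l].
by rewrite /sdz_mul /= lim_phizM mulgA lim_phizD addrA.
Qed.
Lemma sdz_mul1 : left_id sdz_one sdz_mul.
Proof. by case=> g n; rewrite /sdz_mul /= mul1g add0r. Qed.
Lemma sdz_mulr1 : right_id sdz_one sdz_mul.
Proof. by case=> g n; rewrite /sdz_mul /= lim_phiz1 mulg1 addr0. Qed.
Lemma sdz_mulV : left_inverse sdz_one sdz_inv sdz_mul.
Proof.
case=> g n; rewrite /sdz_mul /= -lim_phizM mulVg lim_phiz1.
by rewrite addNr.
Qed.
Lemma sdz_mulrV : right_inverse sdz_one sdz_inv sdz_mul.
Proof.
by case=> g n; rewrite /sdz_mul /= -lim_phizD subrr /= mulgV.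
Qed.

HB.instance Definition _ := isGroup.Build semidirect_int
  sdz_mulA sdz_mul1 sdz_mulr1 sdz_mulV sdz_mulrV.

Definition semidirect_emb (p : semidirect_nat phi) : semidirect_int :=
  (to_lim 0 p.1, p.2%:Z).

End Semidirect.

Arguments semidirect_nat {G} phi.
Arguments semidirect_int {G} phi.
Arguments semidirect_emb {G} phi p.

Section UB.
Context {R : realType} {G : groupType}.
Variables (phi : {multiplicative G -> G}) (B : set (set G)).

Definition ltranslate (g : G) (X : set G) : set G := [set (g * x)%g | x in X].

(* Binary unions and intersections suffice: the empty ones, [set0] and [setT],
   are obtained from [X] and its complement. *)
Definition constructible_closed (C : set (set G)) : Prop :=
  [/\ forall X Y, C X -> C Y -> C (X `|` Y),
      forall X Y, C X -> C Y -> C (X `&` Y),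
      forall X, C X -> C (~` X),
      forall X, C X -> C (phi @` X)
    & forall g X, C X -> C (ltranslate g X)].

Definition constructible : set (set G) := smallest constructible_closed B.

Local Open Scope cstar_scope.

(* [e] is a function on all subsets of [G], but only its values on
   constructible sets matter. *)
Record UB_relations (A : unitalCstarAlgType R)
    (e : set G -> A) (u : G -> A) (s : A) : Prop := {
  UB_projection : forall X, constructible X -> projection (e X);
  UB_unitary : forall g, unitary (u g);
  UB_isometry : isometry s;
  UB_mul : forall g h n m,
    u g * s ^+ n * u h * s ^+ m = u (g * endo_pow phi n h)%g * s ^+ (n + m);
  UB_conj : forall g n X, constructible X ->
    u g * s ^+ n * e X * s^* ^+ n * u (g^-1)%g
      = e (ltranslate g (endo_pow phi n @` X));
  UB_setT : e [set: G] = 1;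
  UB_set0 : e set0 = 0%R;
  UB_setI : forall X Y, constructible X -> constructible Y ->
    e X * e Y = e (X `&` Y);
  UB_setU : forall X Y, constructible X -> constructible Y ->
    (e X + e Y)%R = (e (X `|` Y) + e (X `&` Y))%R
}.

Record is_UB (A : unitalCstarAlgType R)
    (e : set G -> A) (u : G -> A) (s : A) : Prop := {
  is_UB_relations : UB_relations e u s;
  is_UB_generated :
    cstar_generated (e @` constructible `|` range u `|` [set s]) = setT;
  is_UB_universal : forall (A' : unitalCstarAlgType R)
      (e' : set G -> A') (u' : G -> A') (s' : A'),
    UB_relations e' u' s' ->
    exists! f : A -> A',
      [/\ star_hom f, forall X, constructible X -> f (e X) = e' X,
          forall g, f (u g) = u' g & f s = s']
}.

Definition DB (A : unitalCstarAlgType R)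
    (e : set G -> A) (u : G -> A) (s : A) : set A :=
  cstar_generated
    [set x | exists g n H, B H /\
       x = u g * s ^+ n * e H * s^* ^+ n * u (g^-1)%g].

End UB.

Section CrossedProducts.
Context {R : realType}.
Local Open Scope cstar_scope.

Record semigroup_covariant (S : monoidType) (D : unitalCstarAlgType R)
    (alpha : S -> D -> D) (A : unitalCstarAlgType R)
    (iD : D -> A) (iS : S -> A) : Prop := {
  sc_hom : star_hom iD;
  sc_unital : iD 1 = 1;
  sc_isometry : forall p, isometry (iS p);
  sc_mul : forall p q, iS (p * q)%g = iS p * iS q;
  sc_covariance : forall p x, iS p * iD x * (iS p)^* = iD (alpha p x)
}.

Record is_semigroup_crossed_product (S : monoidType)
    (D : unitalCstarAlgType R) (alpha : S -> D -> D)
    (A : unitalCstarAlgType R) (iD : D -> A) (iS : S -> A) : Prop := {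
  scp_covariant : semigroup_covariant alpha iD iS;
  scp_generated : cstar_generated (range iD `|` range iS) = setT;
  scp_universal : forall (A' : unitalCstarAlgType R)
      (iD' : D -> A') (iS' : S -> A'),
    semigroup_covariant alpha iD' iS' ->
    exists! f : A -> A',
      [/\ star_hom f, forall x, f (iD x) = iD' x
        & forall p, f (iS p) = iS' p]
}.

(* The inductive limit over [S], directed by [p < q * p], of copies [D_p] of [D]
   with connecting maps [alpha q : D_p -> D_(q * p)]; [lam p] is the canonical
   map of [D_p] into the limit. *)
Record is_inductive_limit (S : monoidType) (D : cstarAlgType R)
    (alpha : S -> D -> D) (L : cstarAlgType R) (lam : S -> D -> L) : Prop := {
  il_hom : forall p, star_hom (lam p);
  il_compat : forall p q x, lam (q * p)%g (alpha q x) = lam p x;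
  il_universal : forall (L' : cstarAlgType R) (lam' : S -> D -> L'),
    (forall p, star_hom (lam' p)) ->
    (forall p q x, lam' (q * p)%g (alpha q x) = lam' p x) ->
    exists! f : L -> L', star_hom f /\ forall p x, f (lam p x) = lam' p x
}.

Record star_action (T : groupType) (A : cstarAlgType R) (act : T -> A -> A) :
    Prop := {
  sa_hom : forall g, star_hom (act g);
  sa_one : forall x, act 1%g x = x;
  sa_mul : forall g h x, act (g * h)%g x = act g (act h x)
}.

Record minimal_automorphic_dilation (S : monoidType) (T : groupType)
    (emb : S -> T) (D : cstarAlgType R) (alpha : S -> D -> D)
    (L : cstarAlgType R) (lam : S -> D -> L) (act : T -> L -> L) : Prop := {
  mad_limit : is_inductive_limit alpha lam;
  mad_action : star_action act;
  mad_dilation : forall p x, act (emb p) (lam 1%g x) = lam 1%g (alpha p x);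
  mad_minimal :
    closure (\bigcup_p (act (emb p)^-1%g @` range (lam 1%g))) = setT
}.

(* [j a g] stands for the element [a u_g].  The three conditions say that the
   linear extension of [j] is a *-homomorphism on the convolution *-algebra
   C_c(T, A) of finitely supported functions from [T] to [A]; the full crossed
   product is the enveloping C*-algebra of the latter. *)
Record crossed_product_rep (T : groupType) (A : cstarAlgType R)
    (act : T -> A -> A) (P : cstarAlgType R) (j : A -> T -> P) : Prop := {
  cpr_linear : forall g, linear (j^~ g);
  cpr_mul : forall a g b h, j a g * j b h = j (a * act g b) (g * h)%g;
  cpr_adj : forall a g, (j a g)^* = j (act (g^-1)%g (a^*)) (g^-1)%g
}.

Record is_group_crossed_product (T : groupType) (A : cstarAlgType R)
    (act : T -> A -> A) (P : cstarAlgType R) (j : A -> T -> P) : Prop := {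
  gcp_rep : crossed_product_rep act j;
  gcp_generated : cstar_generated [set j a g | a in setT & g in setT] = setT;
  gcp_universal : forall (P' : cstarAlgType R) (j' : A -> T -> P'),
    crossed_product_rep act j' ->
    exists! f : P -> P', star_hom f /\ forall a g, f (j a g) = j' a g
}.

End CrossedProducts.

(* Main.v *)
From HB Require Import structures.
From mathcomp Require Import all_boot all_order all_algebra.
From mathcomp Require Import complex all_classical all_reals topology normedtype.
From mathcomp Require Import zify ring lra.
Require Import Defs.

Set Implicit Arguments.
Unset Strict Implicit.
Unset Printing Implicit Defensive.

(** The first isomorphism compares two universal properties.  The projections
    [e X] of all constructible sets [X] lie in the subalgebra [D]
    ([DB_constructible]), so that the crossed product [C] contains a system of
    generators of [U] ([C_UB_relations]); conversely [D] and the elements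
    [u g * s ^+ n] form a covariant pair in [U].  The two resulting maps are
    inverse to each other ([UB_iso_crossed_product]).

    The second one is a dilation theorem, which needs only that [D] embeds
    isometrically in [C] and that [phi] is injective.  In the crossed product
    [P] by the group, let [q] be the image of the unit of [D].  The elements
    [v p = u_p q] are isometries of the corner [q P q] which implement [alpha],
    whence a map [Psi : C -> q P q].  It is onto, because every element of the
    group is a fraction [p^-1 r] and the compression to the corner of
    [(u_p^-1 x u_p) u_(p^-1 r)], with [x] in [D], is [(v p)^* x (v r)]
    ([corner_in_range]).

    It is injective because [C] is recovered from a representation of [P].
    A representation in which the isometry [s] of [C] becomes unitary exists on
    the inductive limit of [C -> C -> ...] along [c |-> s c s^*].  The limit is
    realized inside the algebra [asymp C] of bounded sequences modulo null
    sequences: the element [c] of the copy of index [m] is the sequence of the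
    [s^(n - m) c (s^* )^(n - m)].  There [s] is the constant sequence, and an
    element of the limit group is the sequence of its coordinates in the copies
    of [G].  This gives a covariant pair up to multiplication by the limit of
    the copies of [D], which is enough for a representation of the crossed
    product ([cpr_of_covariant]).  Composed with [Psi] it sends [c] to the
    sequence of the [s^n c (s^* )^n], whose norm is that of [c]; as
    *-homomorphisms are contractive, [Psi] is isometric ([Psi_isometric]).

    That *-homomorphisms are contractive ([star_hom_contractive]) underlies all
    the arguments by density.  If [h] is selfadjoint of norm less than [1], then
    [h] is the real part of a unitary [h + i sqrt (1 - h^2)] of the unitization,
    which a *-homomorphism sends to a unitary; so the image of [h] has norm at
    most [1].  The square root comes from a contraction
    ([sqrt_fixed_point]). *)

Import Order.TTheory GRing.Theory Num.Theory.
Import numFieldNormedType.Exports.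

Local Open Scope classical_set_scope.
Local Open Scope ring_scope.

(* In the ring notations [+], [-], [*:] the arguments are read in [ring_scope],
   so that the notations of [cstar_scope] are of no use there. *)
Local Notation "x ** y" := (cmul x y) (at level 40, left associativity).
Local Notation "x ^#" := (adj x) (at level 2, format "x ^#").
Local Notation "x ^^ n" := (iter n (cmul x) cone) (at level 29, left associativity).

(** * Real-valued norms, Lipschitz maps and completeness *)

Section RealNorm.
Context {R : realType}.
Implicit Types V W X : normedModType R[i].

(** The norm takes its values in [R[i]], which is only partially ordered;
    estimates are made with this real number instead. *)
Definition nr V (x : V) : R := complex.Re `|x|.

Lemma nrE V (x : V) : `|x| = (nr x)%:C%C.
Proof. by rewrite /nr RRe_real// ger0_real. Qed.

Lemma nr_ge0 V (x : V) : 0 <= nr x.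
Proof. by rewrite -ler0c -nrE. Qed.

Lemma nr0 V : nr (0 : V) = 0.
Proof. by rewrite /nr normr0. Qed.

Lemma nr_eq0 V (x : V) : nr x = 0 -> x = 0.
Proof. by move=> x0; apply/normr0_eq0; rewrite nrE x0. Qed.

Lemma nrN V (x : V) : nr (- x) = nr x.
Proof. by rewrite /nr normrN. Qed.

Lemma nrD V (x y : V) : nr (x + y) <= nr x + nr y.
Proof. by rewrite -lecR rmorphD /= -!nrE ler_normD. Qed.

Lemma nrB V (x y : V) : nr (x - y) <= nr x + nr y.
Proof. by rewrite -(nrN y) nrD. Qed.

Lemma nr_distC V (x y : V) : nr (x - y) = nr (y - x).
Proof. by rewrite -nrN opprB. Qed.

Lemma nr_triangle V (y x z : V) : nr (x - z) <= nr (x - y) + nr (y - z).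
Proof. by rewrite (le_trans _ (nrD _ _))// addrA subrK. Qed.

Definition cabs (a : R[i]) : R := complex.Re `|a|.

Lemma cabsE (a : R[i]) : `|a| = (cabs a)%:C%C.
Proof. by rewrite /cabs RRe_real ?ger0_real. Qed.

Lemma cabs_ge0 (a : R[i]) : 0 <= cabs a.
Proof. by rewrite -ler0c -cabsE. Qed.

Lemma cabs0 : cabs 0 = 0.
Proof. by rewrite /cabs normr0. Qed.

Lemma cabs_gt0 (a : R[i]) : a != 0 -> 0 < cabs a.
Proof. by rewrite -ltcR -cabsE normr_gt0. Qed.

Lemma cabsV (a : R[i]) : cabs a^-1 = (cabs a)^-1.
Proof. by apply: complexI; rewrite fmorphV /= -!cabsE normfV. Qed.

Lemma nrZ V (a : R[i]) (x : V) : nr (a *: x) = cabs a * nr x.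
Proof.
rewrite /cabs {1}/nr normrZ nrE; case: (`|a|) (normr_ge0 a) => c d.
by rewrite lecE /= => /andP[/eqP-> _]; simpc.
Qed.

Lemma nrZr V (a : R) (x : V) : nr (a%:C%C *: x) = `|a| * nr x.
Proof. by rewrite nrZ /cabs normc_def /= expr0n /= addr0 sqrtr_sqr. Qed.

Lemma nr_ball V (x y : V) (e : R) : ball x e%:C%C y <-> nr (x - y) < e.
Proof. by rewrite -ball_normE /ball_ /= nrE ltcR. Qed.

Lemma posC (e : R[i]) : 0 < e -> e = (complex.Re e)%:C%C /\ 0 < complex.Re e.
Proof.
case: e => a b; rewrite ltcE /= => /andP[/eqP-> a0]; split=> //.
Qed.

Lemma closed_nrP V (E : set V) :
  closed E <->
  forall x, (forall e : R, 0 < e -> exists2 y, E y & nr (x - y) < e) -> E x.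
Proof.
split=> [cE x xE|H x xE].
  apply: cE => A /nbhs_ballP[e /= e0 eA]; have [eE re0] := posC e0.
  have [y Ey xy] := xE _ re0; exists y; split=> //; apply: eA.
  by rewrite eE; apply/nr_ball.
apply: H => e e0; have := xE _ (nbhsx_ballx x e%:C%C _).
rewrite ltcR => /(_ e0)[y [Ey xy]]; exists y => //; exact/nr_ball.
Qed.

Lemma closure_nrP V (E : set V) x :
  closure E x <-> (forall e : R, 0 < e -> exists2 y, E y & nr (x - y) < e).
Proof.
split=> [xE e e0|xE A /nbhs_ballP[e /= e0 eA]].
  have := xE _ (nbhsx_ballx x e%:C%C _).
  rewrite ltcR => /(_ e0)[y [Ey xy]]; exists y => //; exact/nr_ball.
have [eE re0] := posC e0.
have [y Ey xy] := xE _ re0; exists y; split=> //; apply: eA.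
by rewrite eE; apply/nr_ball.
Qed.

(** All the maps whose continuity matters below have a global constant, and a
    constant is easier to compose than a limit. *)
Definition lipschitz_map V W (f : V -> W) :=
  exists2 K : R, 0 < K & forall x y, nr (f x - f y) <= K * nr (x - y).

Lemma lipschitz_id V : lipschitz_map (@id V).
Proof. by exists 1 => // x y; rewrite mul1r. Qed.

Lemma lipschitz_comp V W X (g : W -> X) (f : V -> W) :
  lipschitz_map g -> lipschitz_map f -> lipschitz_map (g \o f).
Proof.
move=> [K K0 gK] [L L0 fL]; exists (K * L); first exact: mulr_gt0.
move=> x y; rewrite (le_trans (gK _ _))// -mulrA ler_pM2l//.
Qed.

Lemma lipschitzB V W (f g : V -> W) :
  lipschitz_map f -> lipschitz_map g -> lipschitz_map (fun x => f x - g x).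
Proof.
move=> [K K0 fK] [L L0 gL]; exists (K + L); first exact: addr_gt0.
move=> x y; rewrite mulrDl (_ : _ - _ = (f x - f y) - (g x - g y)).
  by rewrite (le_trans (nrB _ _))// lerD.
by rewrite !opprD !opprK addrACA.
Qed.

Lemma closed_preim_lip V W (f : V -> W) (E : set W) :
  lipschitz_map f -> closed E -> closed (f @^-1` E).
Proof.
move=> [K K0 fK] /closed_nrP cE; apply/closed_nrP => x xE; apply: cE => e e0.
have [|y Ey xy] := xE (e / K); first exact: divr_gt0.
by exists (f y) => //; rewrite (le_lt_trans (fK _ _))// mulrC -ltr_pdivlMr.
Qed.

Lemma closed_eq_lip V W (f g : V -> W) :
  lipschitz_map f -> lipschitz_map g -> closed [set x | f x = g x].
Proof.
move=> fl gl; have -> : [set x | f x = g x] = (fun x => f x - g x) @^-1` [set 0].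
  apply/seteqP; split=> x /=; first by move=> ->; rewrite subrr.
  by move/eqP; rewrite subr_eq0 => /eqP.
apply: closed_preim_lip; first exact: lipschitzB.
apply/closed_nrP => x H; apply: nr_eq0; apply/eqP; rewrite eq_le nr_ge0 andbT.
by apply/ler_addgt0Pr => e /H[y ->]; rewrite subr0 add0r => /ltW.
Qed.

Lemma closed_nr_eq V W (f : V -> W) :
  lipschitz_map f -> closed [set x | nr (f x) = nr x].
Proof.
move=> [K K0 fK]; apply/closed_nrP => x xE /=.
have key (X : normedModType R[i]) (a b : X) : `|nr a - nr b| <= nr (a - b).
  rewrite ler_norml lerBlDr lerNl opprB lerBlDr; apply/andP; split.
    by rewrite nr_distC -{1}(subrK a b) nrD.
  by rewrite -{1}(subrK b a) nrD.
apply/eqP; rewrite -subr_eq0 -normr_eq0 eq_le normr_ge0 andbT.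
apply/ler_addgt0Pr => e e0; rewrite add0r.
have [|y /= Ey xy] := xE (e / (K + 1)); first by rewrite divr_gt0// addr_gt0.
have -> : nr (f x) - nr x = (nr (f x) - nr (f y)) - (nr x - nr y).
  by rewrite Ey; ring.
rewrite (le_trans (ler_normB _ _))// (le_trans (lerD (key _ _ _) (key _ _ _)))//.
rewrite (le_trans (lerD (fK _ _) (lexx _)))// -{2}[nr (x - y)]mul1r -mulrDl.
by rewrite mulrC -ler_pdivlMr ?addr_gt0// ltW.
Qed.

(** Cauchy filters only ever enter through sequences with geometrically small
    increments: a Cauchy filter contains a ball of radius [2^-n] for every
    [n], and fixed points are reached by such sequences. *)
Definition geometric_cauchy V (q c : R) (x : nat -> V) :=
  forall n, nr (x n - x n.+1) <= c * q ^+ n.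

Lemma geometric_small (q c e : R) :
  0 <= q < 1 -> 0 < e -> exists n, c * q ^+ n < e.
Proof.
move=> /andP[q0 q1] e0; have [->|qn0] := eqVneq q 0.
  by exists 1%N; rewrite expr1 mulr0.
have {qn0}q0 : 0 < q by rewrite lt_def qn0.
have t0 : 0 < q^-1 - 1 by rewrite subr_gt0 invf_gt1.
have bern n : 1 + n%:R * (q^-1 - 1) <= q^-1 ^+ n.
  elim: n => [|n IH]; first by rewrite mul0r addr0 expr0.
  rewrite exprS -{2}[q^-1](subrK 1) (addrC (_ - 1)) mulrDl mul1r.
  rewrite -natr1 (mulrDl n%:R) mul1r addrA lerD// ler_peMr ?(ltW t0)//.
  by rewrite exprn_ege1// invf_ge1// ltW.
exists (Num.bound (`|c| / e / (q^-1 - 1))); set n := Num.bound _.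
have qn0 : 0 < q ^+ n by rewrite exprn_gt0.
rewrite (le_lt_trans (ler_wpM2r (ltW qn0) (ler_norm c)))//.
rewrite -ltr_pdivlMr// mulrC -ltr_pdivrMr// -exprVn.
rewrite (lt_le_trans _ (bern n))// ltr_pwDl//.
by rewrite -ler_pdivrMr// ltW// archi_boundP// !divr_ge0// ltW.
Qed.

Lemma geometric_cauchy_dist V (x : nat -> V) (q c : R) n k :
  0 <= q < 1 -> 0 <= c -> geometric_cauchy q c x ->
  nr (x n - x (n + k)%N) <= c / (1 - q) * q ^+ n.
Proof.
move=> /andP[q0 q1] c0 xc; have q10 : 0 < 1 - q by rewrite subr_gt0.
have : nr (x n - x (n + k)%N) <= c / (1 - q) * (q ^+ n - q ^+ (n + k)).
  elim: k => [|k IH]; first by rewrite addn0 !subrr nr0 mulr0.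
  have := xc (n + k)%N; rewrite -addnS => xk.
  rewrite (le_trans (nr_triangle (x (n + k)%N) _ _))// (le_trans (lerD IH xk))//.
  by rewrite addnS exprS le_eqVlt; apply/orP; left; apply/eqP; field; rewrite gt_eqF.
move/le_trans; apply; rewrite ler_wpM2l ?divr_ge0 ?(ltW q10)//.
by rewrite gerBl exprn_ge0.
Qed.

Lemma geometric_cauchy_lim (V : completeNormedModType R[i]) (x : nat -> V)
    (q c : R) :
  0 <= q < 1 -> 0 <= c -> geometric_cauchy q c x ->
  exists l, forall n, nr (x n - l) <= c / (1 - q) * q ^+ n.
Proof.
move=> q01 c0 xc; have : cvg (x @ \oo).
  apply: cauchy_cvg; apply: cauchy_exP => e e0; have [eE re0] := posC e0.
  have [n nP] := geometric_small (c / (1 - q)) q01 re0.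
  exists (x n); exists n => // k /= nk; rewrite eE; apply/nr_ball.
  by rewrite -(subnKC nk) (le_lt_trans (geometric_cauchy_dist _ _ q01 c0 xc)).
move/cvg_ex => [l xl]; exists l => n; apply/ler_addgt0Pr => e e0.
have [k _ kP] := xl _ (nbhsx_ballx l e%:C%C (etrans (ltcR _ _) e0)).
have /nr_ball le := kP (n + k)%N (leq_addl _ _).
rewrite (le_trans (nr_triangle (x (n + k)%N) _ _))// lerD//.
  exact: geometric_cauchy_dist.
by rewrite nr_distC ltW.
Qed.

Lemma half01 : 0 <= (2^-1 : R) < 1.
Proof. by rewrite invr_ge0 ler0n invf_lt1 ?ltr1n. Qed.

(** Completeness of a normed module, tested on the sequences of points chosen in
    small sets of a Cauchy filter. *)
Lemma complete_of_geometric (V : normedModType R[i]) :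
  (forall x : nat -> V, geometric_cauchy 2^-1 1 x ->
    exists l, forall e : R, 0 < e -> exists n0,
      forall n, (n0 <= n)%N -> nr (x n - l) <= e) ->
  forall F : set_system V, ProperFilter F -> cauchy F -> cvg F.
Proof.
move=> H F FF /cauchyP Fc.
have h0 n : 0 < 2^-1 ^+ n :> R by rewrite exprn_gt0// invr_gt0.
have hS n : 2^-1 ^+ n = 2 * 2^-1 ^+ n.+1 :> R.
  by rewrite exprS mulrA divff ?mul1r// pnatr_eq0.
have /choice[x xF] n : exists x : V, F (ball x (2^-1 ^+ n.+1)%:C%C).
  by apply: Fc; rewrite ltcR.
have [n|l lP] := H x.
  have [y []] := filter_ex (filterI (xF n) (xF n.+1)).
  move=> /nr_ball xy /nr_ball yx; rewrite mul1r.
  rewrite (le_trans (nr_triangle y _ _))// [nr (y - _)]nr_distC.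
  rewrite (le_trans (lerD (ltW xy) (ltW yx)))//.
  have := h0 n; rewrite (hS n) (hS n.+1).
  by have := h0 n.+2; lra.
apply/cvg_ex; exists l => A /nbhs_ballP[e /= e0 eA]; have [eE re0] := posC e0.
have [n0 n0P] := lP _ (divr_gt0 re0 (ltr0Sn R 1)).
have [k kP] := geometric_small 1 half01 (divr_gt0 re0 (ltr0Sn R 1)).
apply: filterS (xF (n0 + k)%N) => y /nr_ball xy; apply: eA; rewrite eE.
apply/nr_ball; rewrite (le_lt_trans (nr_triangle (x (n0 + k)%N) _ _))//.
have := n0P (n0 + k)%N (leq_addr _ _); rewrite nr_distC => lx.
have : (2^-1 ^+ (n0 + k).+1 : R) <= 2^-1 ^+ k.
  rewrite ler_wiXn2l ?invr_ge0// ?invf_le1 ?ler1n// -addnS addnC.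
  by rewrite addSn ltnW// ltnS leq_addr.
by move: kP; lra.
Qed.

End RealNorm.

(** * Automatic contractivity of star homomorphisms *)

Section CstarBasics.
Context {R : realType}.
Implicit Types A B : cstarAlgType R.

Lemma cmul0l A (x : A) : 0 ** x = 0.
Proof. by rewrite -{1}(scale0r (0 : A)) cmulZl scale0r. Qed.

Lemma cmul0r A (x : A) : x ** 0 = 0.
Proof. by rewrite -{1}(scale0r (0 : A)) cmulZr scale0r. Qed.

Lemma cmulNl A (x y : A) : (- x) ** y = - (x ** y).
Proof. by rewrite -scaleN1r cmulZl scaleN1r. Qed.

Lemma cmulNr A (x y : A) : x ** (- y) = - (x ** y).
Proof. by rewrite -scaleN1r cmulZr scaleN1r. Qed.

Lemma cmulBl A (x y z : A) : (x - y) ** z = x ** z - y ** z.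
Proof. by rewrite cmulDl cmulNl. Qed.

Lemma cmulBr A (x y z : A) : x ** (y - z) = x ** y - x ** z.
Proof. by rewrite cmulDr cmulNr. Qed.

Lemma adj0 A : (0 : A)^# = 0.
Proof. by rewrite -(scale0r (0 : A)) adjZ conjC0 !scale0r. Qed.

Lemma adjN A (x : A) : (- x)^# = - x^#.
Proof. by rewrite -scaleN1r adjZ rmorphN rmorph1 scaleN1r. Qed.

Lemma adjB A (x y : A) : (x - y)^# = x^# - y^#.
Proof. by rewrite adjD adjN. Qed.

Lemma conj_realC (a : R) : (a%:C%C : R[i])^* = a%:C%C.
Proof. exact: conjc_real. Qed.

Lemma nr_mul A (x y : A) : nr (x ** y) <= nr x * nr y.
Proof. by rewrite -lecR rmorphM /= -!nrE normcM. Qed.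

Lemma nr_adjM A (x : A) : nr (x^# ** x) = nr x ^+ 2.
Proof. by apply: complexI; rewrite rmorphXn /= -!nrE cstar_identity. Qed.

Lemma nr_adj A (x : A) : nr (x^#) = nr x.
Proof.
have le (y : A) : nr y <= nr (y^#).
  have [->|y0] := eqVneq (nr y) 0; first exact: nr_ge0.
  rewrite -(ler_pM2r (_ : 0 < nr y)); last by rewrite lt_def y0 nr_ge0.
  by rewrite -expr2 -nr_adjM nr_mul.
by apply/eqP; rewrite eq_le le -{2}(adjK x) le.
Qed.

Lemma nr_mulM A (x : A) : nr (x ** x^#) = nr x ^+ 2.
Proof. by rewrite -{1}(adjK x) nr_adjM nr_adj. Qed.

Lemma nr_eq_of_adjM A (x y : A) : x^# ** x = y^# ** y -> nr x = nr y.
Proof.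
move=> /(congr1 (@nr R A)); rewrite !nr_adjM => /eqP.
by rewrite eqrXn2 ?nr_ge0// => /eqP.
Qed.

Lemma lipschitz_cmull A (a : A) : lipschitz_map (fun x => a ** x).
Proof.
exists (nr a + 1); first by rewrite ltr_wpDl// nr_ge0.
move=> x y; rewrite -cmulBr (le_trans (nr_mul _ _))// ler_wpM2r ?nr_ge0//.
by rewrite lerDl.
Qed.

Lemma lipschitz_cmulr A (a : A) : lipschitz_map (fun x => x ** a).
Proof.
exists (nr a + 1); first by rewrite ltr_wpDl// nr_ge0.
move=> x y; rewrite -cmulBl (le_trans (nr_mul _ _))// mulrC ler_wpM2r ?nr_ge0//.
by rewrite lerDl.
Qed.

Lemma lipschitz_adj A : lipschitz_map (fun x : A => x^#).
Proof. by exists 1 => // x y; rewrite -adjB nr_adj mul1r. Qed.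

End CstarBasics.

Section StarHom.
Context {R : realType}.
Variables (A B : cstarAlgType R) (f : A -> B).
Hypothesis fhom : star_hom f.

Lemma star_homL : linear f. Proof. by case: fhom. Qed.
Lemma star_homM x y : f (x ** y) = f x ** f y. Proof. by case: fhom. Qed.
Lemma star_homV x : f x^# = (f x)^#. Proof. by case: fhom. Qed.
Lemma star_homD x y : f (x + y) = f x + f y.
Proof. by rewrite -{1}(scale1r x) star_homL scale1r. Qed.
Lemma star_hom0 : f 0 = 0.
Proof. by apply: (addrI (f 0)); rewrite -star_homD !addr0. Qed.
Lemma star_homZ a x : f (a *: x) = a *: f x.
Proof. by rewrite -[a *: x]addr0 star_homL star_hom0 addr0. Qed.
Lemma star_homN x : f (- x) = - f x.
Proof. by rewrite -scaleN1r star_homZ scaleN1r. Qed.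
Lemma star_homB x y : f (x - y) = f x - f y.
Proof. by rewrite star_homD star_homN. Qed.

End StarHom.

Section Contractive.
Context {R : realType}.
Implicit Types A B : cstarAlgType R.

(** With [d] in the role of [1 - sqrt (1 - k^2)], the hypotheses say that
    [w = k + c (1 - d)] is a unitary of the unitization when [c = i] or
    [c = - i]; multiplication by [w] therefore preserves the norm, and this can
    be said without leaving the algebra. *)
Lemma cayley_nr B (k d x : B) (c : R[i]) :
  k^# = k -> d^# = d -> k ** d = d ** k -> k ** k = d + d - d ** d ->
  c^* = - c -> c^* * c = 1 ->
  nr (k ** x + c *: (x - d ** x)) = nr x.
Proof.
move=> ks ds kd kk cN cc; apply: nr_eq_of_adjM.
set a := k ** x; set p := x - d ** x.
have ps : p^# = x^# - x^# ** d by rewrite /p adjB adjM ds.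
have as_ : a^# = x^# ** k by rewrite /a adjM ks.
have ap : a^# ** p = p^# ** a.
  rewrite as_ ps /a /p cmulBr cmulBl -!cmulA; congr (_ - _).
  by congr (_ ** _); rewrite !cmulA kd.
have aapp : a^# ** a + p^# ** p = x^# ** x.
  rewrite as_ ps /a /p cmulBl -!cmulA -cmulBr -cmulDr; congr (_ ** _).
  rewrite [k ** _]cmulA kk cmulBr !cmulBl cmulDl -!cmulA.
  move: (d ** x) (d ** (d ** x)) => y z.
  by rewrite opprB [_ + (z - y)]addrC !addrA subrK addrK addrC addKr.
rewrite adjD adjZ cmulDl !cmulDr !cmulZl !cmulZr -aapp ap scalerA cc scale1r.
by rewrite cN scaleNr -addrA addNKr.
Qed.

(** [2 k^2] is the sum of the images of [k] under the two isometric maps of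
    [cayley_nr] for [c = i] and [c = - i], so that [2 |k|^2 <= 2 |k|]. *)
Lemma nr_le1_of_sqrt B (k d : B) :
  k^# = k -> d^# = d -> k ** d = d ** k -> k ** k = d + d - d ** d ->
  nr k <= 1.
Proof.
move=> ks ds kd kk.
have nkk : nr (k ** k) = nr k ^+ 2 by rewrite -{1}ks nr_adjM.
have [k0|k0] := eqVneq (nr k) 0; first by rewrite k0 ler01.
have wi := @cayley_nr B k d k 'i ks ds kd kk.
have wj := @cayley_nr B k d k (- 'i) ks ds kd kk.
have ci : ('i : R[i])^* = - 'i := conjCi _.
have cj : (- 'i : R[i])^* = - - 'i by rewrite rmorphN; congr (- _).
have ii : ('i : R[i]) * 'i = - 1 by rewrite -expr2 sqrCi.
have {}wi : nr (k ** k + 'i *: (k - d ** k)) = nr k.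
  by apply: wi; rewrite // ci mulNr ii opprK.
have {}wj : nr (k ** k + (- 'i) *: (k - d ** k)) = nr k.
  by apply: wj; rewrite // cj mulrNN mulNr ii opprK.
have : nr ((2 : R)%:C%C *: (k ** k)) <= nr k + nr k.
  rewrite -{1}wi -{1}wj (_ : _ *: _ = (k ** k + 'i *: (k - d ** k)) +
                        (k ** k + (- 'i) *: (k - d ** k))) ?nrD//.
  rewrite scaleNr addrACA subrr addr0 -[k ** k in RHS]scale1r -scalerDl.
  by rewrite rmorphMn /= rmorph1.
rewrite nrZr nkk ger0_norm// expr2 => kk2.
have : nr k * nr k <= nr k by lra.
by rewrite ger_pMr// lt_def k0 nr_ge0.
Qed.

Lemma closed_seq (V : normedModType R[i]) (E : set V) (x : nat -> V) l :
  closed E -> (forall n, E (x n)) ->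
  (forall e : R, 0 < e -> exists n, nr (x n - l) < e) -> E l.
Proof.
move=> /closed_nrP cE xE xl; apply: cE => e /xl[n nl].
by exists (x n) => //; rewrite nr_distC.
Qed.

(** The element [1 - sqrt (1 - h^2)], found as the fixed point of the
    contraction [d |-> (h^2 + d^2) / 2] on the ball of radius
    [1 - sqrt (1 - |h|^2)]. *)
Lemma sqrt_fixed_point A (h : A) : h^# = h -> nr h < 1 ->
  exists d, [/\ d^# = d, h ** d = d ** h & h ** h = d + d - d ** d].
Proof.
move=> hs h1; pose q := nr (h ** h).
have q0 : 0 <= q := nr_ge0 _.
have q1 : q < 1 by rewrite /q -{1}hs nr_adjM expr_lt1// nr_ge0.
(* t is the fixed point of x |-> (q + x^2) / 2: the ball of radius t is stable,
   and t is a Lipschitz constant there *)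
pose r := Num.sqrt (1 - q); pose t := 1 - r.
have r0 : 0 < r by rewrite sqrtr_gt0 subr_gt0.
have rr : r ^+ 2 = 1 - q by rewrite sqr_sqrtr// subr_ge0 ltW.
have r1 : r <= 1 by rewrite -sqrtr1 ler_wsqrtr// gerBl.
have t01 : 0 <= t < 1 by rewrite subr_ge0 r1 gtrBl.
have [t0 t1] := andP t01.
have qt : q + t ^+ 2 = 2 * t by rewrite /t sqrrB rr; ring.
pose T (d : A) : A := (2^-1 : R)%:C%C *: (h ** h + d ** d).
pose x n := iter n T 0.
have half0 : 0 <= (2^-1 : R) by rewrite invr_ge0.
have nrT d d' : nr (T d - T d') <= 2^-1 * ((nr d + nr d') * nr (d - d')).
  rewrite /T -scalerBr nrZr ger0_norm// ler_wpM2l// opprD addrACA subrr add0r.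
  have -> : d ** d - d' ** d' = d ** (d - d') + (d - d') ** d'.
    by rewrite cmulBr cmulBl addrA subrK.
  by rewrite (le_trans (nrD _ _))// mulrDl lerD// (le_trans (nr_mul _ _))// mulrC.
have xt n : nr (x n) <= t.
  elim: n => [|n IH]; first by rewrite nr0.
  rewrite /= /T nrZr ger0_norm// mulrC ler_pdivrMr// mulrC -qt.
  rewrite (le_trans (nrD _ _))// lerD// (le_trans (nr_mul _ _))// expr2.
  by rewrite ler_pM// nr_ge0.
have xc : geometric_cauchy t t x.
  move=> n; elim: n => [|n IH].
    rewrite expr0 mulr1 sub0r nrN /= /T nrZr ger0_norm// cmul0l addr0.
    rewrite mulrC ler_pdivrMr// mulrC -qt -/q lerDl sqr_ge0//.
  rewrite exprS mulrCA (le_trans (nrT _ _))//.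
  rewrite (le_trans _ (ler_wpM2l t0 IH))// mulrA ler_wpM2r ?nr_ge0//.
  by rewrite mulrC ler_pdivrMr// mulr_natr mulr2n lerD ?xt// (xt n.+1).
have [l lP] := geometric_cauchy_lim t01 t0 xc.
have xl (e : R) : 0 < e -> exists n, nr (x n - l) < e.
  move=> e0; have [n nP] := geometric_small (t / (1 - t)) t01 e0.
  by exists n; exact: le_lt_trans (lP n) nP.
have lT : l = T l.
  have TE (y : A) : nr y <= 1 -> nr (T y - T l) <= (1 + nr l) * nr (y - l).
    move=> y1; rewrite (le_trans (nrT _ _))// mulrA ler_wpM2r ?nr_ge0//.
    by have := nr_ge0 l; lra.
  apply/eqP; rewrite -subr_eq0; apply/eqP/nr_eq0/eqP.
  rewrite eq_le nr_ge0 andbT; apply/ler_addgt0Pr => e e0; rewrite add0r.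
  pose c := t / (1 - t).
  have [n nP] := geometric_small ((2 + nr l) * c) t01 e0.
  rewrite (le_trans (nr_triangle (x n.+1) _ _))// (le_trans _ (ltW nP))//.
  rewrite [nr (l - _)]nr_distC.
  have c0 : 0 <= c by rewrite divr_ge0// subr_ge0 ltW.
  have a1 : nr (x n.+1 - l) <= c * t ^+ n.
    rewrite (le_trans (lP _))// ler_wpM2l// exprS ler_piMl ?exprn_ge0// ltW//.
  have a2 : nr (x n.+1 - T l) <= (1 + nr l) * (c * t ^+ n).
    rewrite (le_trans (TE _ _))//; first by rewrite (le_trans (xt n))// ltW.
    by rewrite ler_wpM2l ?addr_ge0 ?nr_ge0.
  by move: a1 a2; rewrite -!mulrA mulrDl; lra.
exists l; split.
- apply: (closed_seq (E := [set d | d^# = d])) xl.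
    exact: closed_eq_lip (lipschitz_adj _) (lipschitz_id _).
  elim=> [|n IH] /=; first exact: adj0.
  by rewrite /T adjZ adjD !adjM hs IH /= conj_realC.
- apply: (closed_seq (E := [set d | h ** d = d ** h])) xl.
    exact: closed_eq_lip (lipschitz_cmull _) (lipschitz_cmulr _).
  elim=> [|n IH] /=; first by rewrite cmul0l cmul0r.
  rewrite /T cmulZr cmulZl cmulDl cmulDr -!cmulA.
  by congr (_ *: (_ + _)); rewrite -IH !cmulA IH.
- have : (2 : R)%:C%C *: l = h ** h + l ** l.
    rewrite {1}lT /T scalerA -rmorphM /= divff ?pnatr_eq0// rmorph1 scale1r//.
  by rewrite rmorphMn /= rmorph1 -scalerMnl scale1r mulr2n => ->; rewrite addrK.
Qed.

(** Continuity of *-homomorphisms is automatic; no spectral theory is needed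
    because [1 - sqrt (1 - h^2)] is transported algebraically by [f]. *)
Theorem star_hom_contractive A B (f : A -> B) :
  star_hom f -> forall x, nr (f x) <= nr x.
Proof.
move=> fh.
have unit h : h^# = h -> nr h < 1 -> nr (f h) <= 1.
  move=> hs h1; have [d [ds hd hh]] := sqrt_fixed_point hs h1.
  apply: (@nr_le1_of_sqrt _ _ (f d)); rewrite -?star_homV -?star_homM//.
  - by rewrite hs.
  - by rewrite ds.
  - by rewrite hd.
  - by rewrite hh star_homB// star_homD// star_homM.
have sa h : h^# = h -> nr (f h) <= nr h.
  move=> hs; apply/ler_addgt0Pr => e e0.
  have c0 : 0 < nr h + e by rewrite ltr_wpDl// nr_ge0.
  have := unit (((nr h + e)^-1)%:C%C *: h).
  rewrite adjZ hs conj_realC star_homZ// !nrZr gtr0_norm ?invr_gt0//.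
  rewrite ![_^-1 * _]mulrC ltr_pdivrMr// mul1r ltrDl ler_pdivrMr// mul1r.
  by move=> /(_ erefl e0).
move=> x; have := sa (x^# ** x).
rewrite adjM adjK star_homM// star_homV// !nr_adjM => /(_ erefl).
by rewrite ler_sqr ?nnegrE ?nr_ge0.
Qed.

Lemma lipschitz_star_hom A B (f : A -> B) : star_hom f -> lipschitz_map f.
Proof.
move=> fh; exists 1 => // x y.
by rewrite -star_homB// mul1r star_hom_contractive.
Qed.

End Contractive.

(** * Closed subalgebras as algebras *)

Section ClosedSubalgebra.
Context {R : realType} {A : cstarAlgType R} {E : set A}.

(** Universal properties speak of algebras that are types; a closed subalgebra
    to which one is applied has to become a type as well. *)
Definition subcstar (cE : cstar_subalgebra E) : Type := {x : A | x \in E}.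

Variable cE : cstar_subalgebra E.
Local Notation T := (subcstar cE).

HB.instance Definition _ := SubChoice.on T.

Fact subcstar_submod : subsemimod_closed [in E].
Proof.
have [_ [E0 ED EZ _ _]] := cE; split; first split.
- by rewrite inE.
- by move=> x y; rewrite !inE; exact: ED.
- by move=> a x; rewrite !inE; exact: EZ.
Qed.
HB.instance Definition _ :=
  GRing.SubChoice_isSubLmodule.Build R[i] A [in E] T subcstar_submod.

Let nrm (x : T) : R[i] := `|val x|.
Fact subcstar_normD x y : nrm (x + y) <= nrm x + nrm y.
Proof. exact: ler_normD. Qed.
Fact subcstar_normZ (a : R[i]) x : nrm (a *: x) = `|a| * nrm x.
Proof. exact: normrZ. Qed.
Fact subcstar_norm0 x : nrm x = 0 -> x = 0.
Proof. by move=> /normr0_eq0 x0; apply: val_inj; rewrite x0. Qed.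
HB.instance Definition _ := Lmodule_isNormed.Build R[i] T
  subcstar_normD subcstar_normZ subcstar_norm0.

Lemma nr_subcstar (x : T) : nr x = nr (val x).
Proof. by []. Qed.

Fact subcstar_complete (F : set_system T) : ProperFilter F -> cauchy F -> cvg F.
Proof.
apply: complete_of_geometric => x xc.
have [l lP] := geometric_cauchy_lim (half01 (R := R)) ler01
  (xc : geometric_cauchy 2^-1 1 (fun n => val (x n))).
have xl (e : R) : 0 < e ->
    exists n0, forall n, (n0 <= n)%N -> nr (val (x n) - l) <= e.
  move=> e0; have [n0 n0P] := geometric_small (1 / (1 - 2^-1)) (half01 (R := R)) e0.
  exists n0 => n n0n; rewrite (le_trans (lP n))// (le_trans _ (ltW n0P))//.
  rewrite ler_wpM2l ?divr_ge0// ?subr_ge0 ?invf_le1 ?ler1n//.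
  by rewrite ler_wiXn2l ?invr_ge0// invf_le1 ?ler1n.
have El : l \in E.
  have [cl _] := cE; rewrite inE; apply: (closed_seq (x := fun n => val (x n)) cl).
    by move=> n; rewrite -inE; exact: valP.
  move=> e e0; have [n0 n0P] := xl _ (divr_gt0 e0 (ltr0Sn R 1)).
  by exists n0; have := n0P n0 (leqnn _); lra.
by exists (Sub l El : T).
Qed.
HB.instance Definition _ := Uniform_isComplete.Build T subcstar_complete.

Fact subcstar_mulP (x y : T) : val x ** val y \in E.
Proof.
have [_ [_ _ _ EM _]] := cE; rewrite inE; apply: EM; rewrite -inE; exact: valP.
Qed.
Fact subcstar_adjP (x : T) : (val x)^# \in E.
Proof. by have [_ [_ _ _ _ EV]] := cE; rewrite inE; apply: EV; rewrite -inE; exact: valP. Qed.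

Let mul (x y : T) : T := Sub (val x ** val y) (subcstar_mulP x y).
Let star (x : T) : T := Sub (val x)^# (subcstar_adjP x).

Fact subcstar_mulA : associative mul.
Proof. by move=> x y z; apply: val_inj; exact: cmulA. Qed.
Fact subcstar_mulDl : left_distributive mul +%R.
Proof. by move=> x y z; apply: val_inj; exact: cmulDl. Qed.
Fact subcstar_mulDr : right_distributive mul +%R.
Proof. by move=> x y z; apply: val_inj; exact: cmulDr. Qed.
Fact subcstar_mulZl (a : R[i]) (x y : T) : mul (a *: x) y = a *: mul x y.
Proof. by apply: val_inj; exact: cmulZl. Qed.
Fact subcstar_mulZr (a : R[i]) (x y : T) : mul x (a *: y) = a *: mul x y.
Proof. by apply: val_inj; exact: cmulZr. Qed.
Fact subcstar_normM (x y : T) : `|mul x y| <= `|x| * `|y|.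
Proof. exact: normcM. Qed.
Fact subcstar_adjK : involutive star.
Proof. by move=> x; apply: val_inj; exact: adjK. Qed.
Fact subcstar_adjD : {morph star : x y / x + y}.
Proof. by move=> x y; apply: val_inj; exact: adjD. Qed.
Fact subcstar_adjZ (a : R[i]) x : star (a *: x) = a^* *: star x.
Proof. by apply: val_inj; exact: adjZ. Qed.
Fact subcstar_adjM x y : star (mul x y) = mul (star y) (star x).
Proof. by apply: val_inj; exact: adjM. Qed.
Fact subcstar_cstar x : `|mul (star x) x| = `|x| ^+ 2.
Proof. exact: cstar_identity. Qed.

HB.instance Definition _ := isCstarAlgebra.Build R T
  subcstar_mulA subcstar_mulDl subcstar_mulDr subcstar_mulZl subcstar_mulZr
  subcstar_normM subcstar_adjK subcstar_adjD subcstar_adjZ subcstar_adjM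
  subcstar_cstar.

Definition subval (x : T) : A := val x.

Lemma subval_hom : star_hom subval.
Proof. by []. Qed.

Lemma subval_inj : injective subval.
Proof. exact: val_inj. Qed.

Lemma subvalP (x : T) : E (subval x).
Proof. by rewrite -inE; exact: valP. Qed.

(** Elements outside of [E] are sent to [0]. *)
Definition subcorestr (x : A) : T := insubd (0 : T) x.

Lemma subcorestrK (x : A) : E x -> subval (subcorestr x) = x.
Proof. by move=> Ex; rewrite /subval insubdK// inE. Qed.

Lemma subcorestr_hom (B : cstarAlgType R) (f : B -> A) :
  star_hom f -> (forall x, E (f x)) -> star_hom (subcorestr \o f).
Proof.
move=> fh fE; split=> [a x y|x y|x]; apply: subval_inj => /=.
- by rewrite (star_homL subval_hom) !subcorestrK// star_homL.
- by rewrite (star_homM subval_hom) !subcorestrK// star_homM.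
- by rewrite (star_homV subval_hom) !subcorestrK// star_homV.
Qed.

End ClosedSubalgebra.

(** The unit of [E] is part of the data because it need not be a unit of the
    ambient algebra: in a corner it is the projection that cuts it out. *)
Record unit_of (R : realType) (A : cstarAlgType R) (E : set A) := UnitOf {
  unit_elt :> A;
  unit_mem : E unit_elt;
  unit_mull : forall x, E x -> unit_elt ** x = x;
  unit_mulr : forall x, E x -> x ** unit_elt = x }.

Definition unital_subcstar (R : realType) (A : cstarAlgType R) (E : set A)
  (cE : cstar_subalgebra E) (q : unit_of E) : Type := subcstar cE.

Section UnitalSubalgebra.
Context {R : realType} {A : cstarAlgType R} {E : set A}.
Variables (cE : cstar_subalgebra E) (q : unit_of E).
HB.instance Definition _ := CstarAlgebra.on (unital_subcstar cE q).

Let one : unital_subcstar cE q := subcorestr cE q.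
Fact unital_subcstar_mul1 : left_id one cmul.
Proof.
move=> x; apply: subval_inj; rewrite (star_homM (subval_hom _)).
by rewrite subcorestrK ?unit_mull//; [exact: subvalP|exact: unit_mem].
Qed.
Fact unital_subcstar_mulr1 : right_id one cmul.
Proof.
move=> x; apply: subval_inj; rewrite (star_homM (subval_hom _)).
by rewrite subcorestrK ?unit_mulr//; [exact: subvalP|exact: unit_mem].
Qed.
HB.instance Definition _ := hasCstarUnit.Build R (unital_subcstar cE q)
  unital_subcstar_mul1 unital_subcstar_mulr1.

Definition usubval (x : unital_subcstar cE q) : A := @subval R A E cE x.
Definition usubcorestr (x : A) : unital_subcstar cE q := subcorestr cE x.

Lemma usubval_hom : star_hom usubval.
Proof. by []. Qed.

Lemma usubval_inj : injective usubval.
Proof. exact: val_inj. Qed.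

Lemma usubvalP x : E (usubval x).
Proof. exact: subvalP. Qed.

Lemma usubcorestrK x : E x -> usubval (usubcorestr x) = x.
Proof. exact: subcorestrK. Qed.

Lemma usubval1 : usubval cone = q.
Proof. by apply: subcorestrK; exact: unit_mem. Qed.

End UnitalSubalgebra.

(** * Bounded sequences modulo null sequences *)

Section BoundedSequences.
Context {R : realType}.
Variable A : cstarAlgType R.
Implicit Types f g : nat -> A.

Definition bounded_seq f := exists c : R, forall n, nr (f n) <= c.

(** The upper bounds of the limit superior of the norms are easier to combine
    than its value, which is recovered from them as an infimum. *)
Definition limsup_le f (t : R) := forall e : R, 0 < e ->
  exists n0, forall n, (n0 <= n)%N -> nr (f n) <= t + e.

Lemma limsup_le_eventually f g t : limsup_le f t ->
  (exists n0, forall n, (n0 <= n)%N -> nr (g n) <= nr (f n)) -> limsup_le g t.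
Proof.
move=> ft [n1 gf] e /ft[n0 n0P]; exists (maxn n0 n1) => n.
rewrite geq_max => /andP[n0n n1n].
exact: le_trans (gf _ n1n) (n0P _ n0n).
Qed.

Lemma limsup_leW f (s t : R) : s <= t -> limsup_le f s -> limsup_le f t.
Proof.
move=> st fs e /fs[n0 n0P]; exists n0 => n /n0P/le_trans; apply.
by rewrite lerD2r.
Qed.

Lemma limsup_leD f g s t :
  limsup_le f s -> limsup_le g t -> limsup_le (fun n => f n + g n) (s + t).
Proof.
move=> fs gt_ e e0; have e20 : 0 < e / 2 by rewrite divr_gt0.
have [n0 n0P] := fs _ e20; have [n1 n1P] := gt_ _ e20.
exists (maxn n0 n1) => n; rewrite geq_max => /andP[/n0P fn /n1P gn].
by rewrite (le_trans (nrD _ _))//; lra.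
Qed.

Lemma limsup_leM f g s t : 0 <= s -> 0 <= t ->
  limsup_le f s -> limsup_le g t -> limsup_le (fun n => f n ** g n) (s * t).
Proof.
move=> s0 t0 fs gt_ e e0; pose d := Num.min 1 (e / (s + t + 1)).
have st0 : 0 < s + t + 1 by rewrite ltr_wpDl// addr_ge0.
have d0 : 0 < d by rewrite lt_min ltr01 divr_gt0.
have d1 : d <= 1 by rewrite ge_min lexx.
have de : d * (s + t + 1) <= e by rewrite -ler_pdivlMr// ge_min lexx orbT.
have [n0 n0P] := fs _ d0; have [n1 n1P] := gt_ _ d0.
exists (maxn n0 n1) => n; rewrite geq_max => /andP[/n0P fn /n1P gn].
rewrite (le_trans (nr_mul _ _))// (le_trans (ler_pM _ _ fn gn)) ?nr_ge0//.
by nra.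
Qed.

Lemma limsup_leZ (a : R[i]) f t :
  limsup_le f t -> limsup_le (fun n => a *: f n) (cabs a * t).
Proof.
have a0 : 0 <= cabs a by exact: cabs_ge0.
move=> ft e e0; have [|n0 n0P] := ft (e / (cabs a + 1)).
  by rewrite divr_gt0// ltr_wpDl.
exists n0 => n /n0P fn; rewrite nrZ (le_trans (ler_wpM2l a0 fn))// mulrDr lerD2l.
by rewrite mulrCA ler_piMr ?(ltW e0)// ler_pdivrMr ?mul1r ?lerDl// ltr_wpDl.
Qed.

Lemma limsup_le_sqrt f t : 0 <= t ->
  limsup_le (fun n => (f n)^# ** f n) t -> limsup_le f (Num.sqrt t).
Proof.
move=> t0 ft e e0; have [|n0 n0P] := ft (e ^+ 2); first by rewrite exprn_gt0.
exists n0 => n /n0P; rewrite nr_adjM => fn.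
have te0 : 0 <= Num.sqrt t + e by rewrite addr_ge0 ?sqrtr_ge0// ltW.
rewrite -ler_sqr ?nnegrE ?nr_ge0// (le_trans fn)// sqrrD sqr_sqrtr// -addrA lerD2l lerDr.
by rewrite mulrn_wge0// mulr_ge0 ?sqrtr_ge0// ltW.
Qed.

Definition limsup_nr f : R := inf [set t | 0 <= t /\ limsup_le f t].

Lemma limsup_nr_ge0 f : 0 <= limsup_nr f.
Proof.
rewrite /limsup_nr; set X := [set t | _].
have [->|/set0P X0] := eqVneq X set0; first by rewrite inf0.
by apply: lb_le_inf => // t [].
Qed.

Lemma limsup_nr_le f t : 0 <= t -> limsup_le f t -> limsup_nr f <= t.
Proof. by move=> t0 ft; apply: ge_inf => //; exists 0 => s []. Qed.

Lemma limsup_le_nr f : bounded_seq f -> limsup_le f (limsup_nr f).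
Proof.
move=> [c fc]; set X := [set t | 0 <= t /\ limsup_le f t].
have hX : has_inf X.
  split; last by exists 0 => s [].
  exists c; split; first exact: le_trans (nr_ge0 _) (fc 0%N).
  by move=> e e0; exists 0%N => n _; rewrite (le_trans (fc n))// lerDl ltW.
move=> e e0; have e20 : 0 < e / 2 by rewrite divr_gt0.
have [t [_ tf] tX] := inf_adherent e20 hX.
have [n0 n0P] := tf _ e20; exists n0 => n /n0P fn.
by rewrite (le_trans fn)//; rewrite /limsup_nr -/X; lra.
Qed.

End BoundedSequences.

Section AsymptoticAlgebra.
Context {R : realType}.
Variable A : unitalCstarAlgType R.
Implicit Types f g : nat -> A.

Definition bseq_set : set (nat -> A) := [set f | bounded_seq f].
Definition bseq : Type := {f : nat -> A | f \in bseq_set}.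
HB.instance Definition _ := SubChoice.on bseq.

Fact bounded_seqD f g :
  bounded_seq f -> bounded_seq g -> bounded_seq (fun n => f n + g n).
Proof.
move=> [c fc] [d gd]; exists (c + d) => n.
by rewrite (le_trans (nrD _ _))// lerD.
Qed.

Fact bounded_seqZ (a : R[i]) f : bounded_seq f -> bounded_seq (fun n => a *: f n).
Proof.
move=> [c fc]; by exists (cabs a * c) => n; rewrite nrZ ler_wpM2l// cabs_ge0.
Qed.

Fact bounded_seqM f g :
  bounded_seq f -> bounded_seq g -> bounded_seq (fun n => f n ** g n).
Proof.
move=> [c fc] [d gd]; exists (c * d) => n.
by rewrite (le_trans (nr_mul _ _))// ler_pM ?nr_ge0.
Qed.

Fact bounded_seqV f : bounded_seq f -> bounded_seq (fun n => (f n)^#).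
Proof. by move=> [c fc]; exists c => n; rewrite nr_adj. Qed.

Fact bseq_submod : subsemimod_closed [in bseq_set].
Proof.
split; first split.
- by rewrite inE; exists 0 => n; rewrite nr0.
- by move=> f g; rewrite !inE; exact: bounded_seqD.
- by move=> a f; rewrite !inE; exact: bounded_seqZ.
Qed.
HB.instance Definition _ := GRing.SubChoice_isSubLmodule.Build R[i] (nat -> A)
  [in bseq_set] bseq bseq_submod.

Lemma bseqP (x : bseq) : bounded_seq (val x).
Proof. by have := valP x; rewrite inE. Qed.

Definition null_seq : {pred bseq} := [pred x | `[< limsup_le (val x) 0 >]].

Fact null_seq_closed : zmod_closed null_seq.
Proof.
split; first by apply/asboolP => e e0; exists 0%N => n _; rewrite nr0 add0r ltW.
move=> x y /asboolP x0 /asboolP y0; apply/asboolP.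
have := limsup_leD x0 (limsup_leZ (-1) y0).
rewrite mulr0 addr0 => /limsup_le_eventually; apply; exists 0%N => n _ /=.
by rewrite scaleN1r.
Qed.
HB.instance Definition _ := GRing.isZmodClosed.Build bseq null_seq null_seq_closed.

(** The algebra [l^oo (A) / c_0 (A)].  It contains the inductive limits of
    sequences of isometric endomorphisms of [A], and it is complete without a
    completion. *)
Definition asymp : Type := Quotient.quot null_seq.
HB.instance Definition _ := GRing.Zmodule.on asymp.

(** Unbounded sequences are sent to [0]. *)
Definition cls f : asymp := \pi_(asymp)%qT (insubd (0 : bseq) f).
Definition rep (x : asymp) : nat -> A := val (repr x).

Lemma repP x : bounded_seq (rep x). Proof. exact: bseqP. Qed.

Lemma repK x : cls (rep x) = x.
Proof. by rewrite /cls /rep valKd reprK. Qed.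

Lemma cls_eqP f g : bounded_seq f -> bounded_seq g ->
  cls f = cls g <-> limsup_le (fun n => f n - g n) 0.
Proof.
move=> fb gb; have eqE : (cls f == cls g) = (insubd (0 : bseq) f - insubd 0 g \in null_seq).
  by rewrite Quotient.idealrBE.
split=> [/eqP|fg]; last apply/eqP; rewrite eqE.
  by move=> /asboolP; rewrite /= !insubdK ?inE.
by apply/asboolP; rewrite /= !insubdK ?inE.
Qed.

Lemma cls_eventually f g : bounded_seq f -> bounded_seq g ->
  (exists n0, forall n, (n0 <= n)%N -> f n = g n) -> cls f = cls g.
Proof.
move=> fb gb [n0 n0P]; apply/cls_eqP => // e e0; exists n0 => n /n0P->.
by rewrite subrr nr0 add0r ltW.
Qed.

Lemma rep_cls f : bounded_seq f -> limsup_le (fun n => rep (cls f) n - f n) 0.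
Proof. by move=> fb; apply/cls_eqP => //; [exact: repP|rewrite repK]. Qed.

Lemma clsD f g : bounded_seq f -> bounded_seq g ->
  cls f + cls g = cls (fun n => f n + g n).
Proof.
move=> fb gb; rewrite /cls -[LHS]Quotient.pi_add; congr (\pi_(_)%qT _).
by apply: val_inj; rewrite /= !insubdK ?inE//; exact: bounded_seqD.
Qed.

Let scale (a : R[i]) (x : asymp) : asymp := cls (fun n => a *: rep x n).

Lemma cls_scale a f : bounded_seq f -> scale a (cls f) = cls (fun n => a *: f n).
Proof.
move=> fb; apply/cls_eqP; [exact/bounded_seqZ/repP|exact: bounded_seqZ|].
have := limsup_leZ a (rep_cls fb); rewrite mulr0.
by move=> /limsup_le_eventually; apply; exists 0%N => n _; rewrite scalerBr.
Qed.

Fact asymp_scalerA a b x : scale a (scale b x) = scale (a * b) x.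
Proof.
rewrite -(repK x) !cls_scale//; do ?exact: repP; last exact/bounded_seqZ/repP.
by congr cls; apply/funext => n; rewrite scalerA.
Qed.
Fact asymp_scale1r : left_id 1 scale.
Proof.
move=> x; rewrite -(repK x) cls_scale; last exact: repP.
by congr cls; apply/funext => n; rewrite scale1r.
Qed.
Fact asymp_scalerDr : right_distributive scale +%R.
Proof.
move=> a x y; rewrite -(repK x) -(repK y); have xb := repP x; have yb := repP y.
rewrite clsD// !cls_scale//; last exact: bounded_seqD.
rewrite clsD; do ?exact: bounded_seqZ.
by congr cls; apply/funext => n; rewrite scalerDr.
Qed.
Fact asymp_scalerDl x : {morph scale^~ x : a b / a + b}.
Proof.
move=> a b; rewrite -(repK x); have xb := repP x.
rewrite !cls_scale// clsD; do ?exact: bounded_seqZ.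
by congr cls; apply/funext => n; rewrite scalerDl.
Qed.
HB.instance Definition _ := GRing.Zmodule_isLmodule.Build R[i] asymp
  asymp_scalerA asymp_scale1r asymp_scalerDr asymp_scalerDl.

Lemma clsZ a f : bounded_seq f -> a *: cls f = cls (fun n => a *: f n).
Proof. exact: cls_scale. Qed.

Let nrm (x : asymp) : R[i] := (limsup_nr (rep x))%:C%C.

Lemma limsup_nr_cls f t : bounded_seq f -> 0 <= t ->
  limsup_nr (rep (cls f)) <= t <-> limsup_le f t.
Proof.
move=> fb t0; split=> [ft|ft].
  have := limsup_leD (limsup_leW ft (limsup_le_nr (repP _)))
    (limsup_leZ (-1) (rep_cls fb)).
  rewrite mulr0 addr0 => /limsup_le_eventually; apply; exists 0%N => n _.
  by rewrite scaleN1r opprB addrC subrK.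
apply: limsup_nr_le => //; have := limsup_leD (rep_cls fb) ft.
rewrite add0r => /limsup_le_eventually; apply; exists 0%N => n _.
by rewrite subrK.
Qed.

Fact asymp_normD x y : nrm (x + y) <= nrm x + nrm y.
Proof.
rewrite -rmorphD /= lecR -{1}(repK x) -{1}(repK y); set f := rep x; set g := rep y.
have fb : bounded_seq f := repP x; have gb : bounded_seq g := repP y.
rewrite clsD//; apply/limsup_nr_cls; first exact: bounded_seqD.
  by rewrite addr_ge0// limsup_nr_ge0.
by apply: limsup_leD; exact: limsup_le_nr.
Qed.

Fact asymp_normZ_le a x :
  limsup_nr (rep (a *: x)) <= cabs a * limsup_nr (rep x).
Proof.
have xb := repP x; rewrite -{1}(repK x) clsZ//; apply/limsup_nr_cls.
- exact: bounded_seqZ.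
- by rewrite mulr_ge0 ?limsup_nr_ge0 ?cabs_ge0.
- by apply: limsup_leZ; exact: limsup_le_nr.
Qed.

Fact asymp_normZ (a : R[i]) x : nrm (a *: x) = `|a| * nrm x.
Proof.
rewrite cabsE /nrm -rmorphM /=; congr (_%:C%C); apply/eqP.
rewrite eq_le asymp_normZ_le /=; have [->|a0] := eqVneq a 0.
  by rewrite cabs0 mul0r limsup_nr_ge0.
rewrite -ler_pdivlMl ?cabs_gt0//; have := asymp_normZ_le a^-1 (a *: x).
by rewrite scalerA mulVf// scale1r cabsV.
Qed.

Fact asymp_norm0 x : nrm x = 0 -> x = 0.
Proof.
move=> /complexI x0; have := limsup_le_nr (repP x); rewrite x0 => xn.
rewrite -(repK x) -(scale0r (cls (rep x))) clsZ; last exact: repP.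
apply/cls_eqP; [exact: repP|exact/bounded_seqZ/repP|].
apply: limsup_le_eventually xn _; exists 0%N => n _.
by rewrite scale0r subr0.
Qed.
HB.instance Definition _ := Lmodule_isNormed.Build R[i] asymp
  asymp_normD asymp_normZ asymp_norm0.

Lemma nr_clsP f t : bounded_seq f -> 0 <= t -> nr (cls f) <= t <-> limsup_le f t.
Proof. exact: limsup_nr_cls. Qed.

Lemma nr_cls f : bounded_seq f -> limsup_le f (nr (cls f)).
Proof. by move=> fb; apply/nr_clsP => //; exact: nr_ge0. Qed.

Lemma clsN f : bounded_seq f -> - cls f = cls (fun n => - f n).
Proof.
move=> fb; rewrite -scaleN1r clsZ//.
by congr cls; apply/funext => n; rewrite scaleN1r.
Qed.

Lemma bounded_seqB f g :
  bounded_seq f -> bounded_seq g -> bounded_seq (fun n => f n - g n).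
Proof.
move=> [c fc] [d gd]; exists (c + d) => n.
by rewrite (le_trans (nrB _ _))// lerD.
Qed.

Lemma clsB f g : bounded_seq f -> bounded_seq g ->
  cls f - cls g = cls (fun n => f n - g n).
Proof.
move=> fb gb; rewrite clsN// clsD//; have [c gc] := gb.
by exists c => n; rewrite nrN.
Qed.

(** A diagonal sequence: at the index [n] it follows the last approximant
    [x k], [k <= n], whose distance to its predecessors has already dropped to
    the size predicted by the norm of the quotient. *)
Fact asymp_complete (F : set_system asymp) : ProperFilter F -> cauchy F -> cvg F.
Proof.
apply: complete_of_geometric => x xc.
have h0 n : 0 < 2^-1 ^+ n :> R by rewrite exprn_gt0// invr_gt0.
have hS n : 2^-1 ^+ n = 2 * 2^-1 ^+ n.+1 :> R.
  by rewrite exprS mulrA divff ?mul1r// pnatr_eq0.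
pose f k := rep (x k); have fb k : bounded_seq (f k) := repP (x k).
have fE k : cls (f k) = x k := repK (x k).
have close k : exists N, forall n, (N <= n)%N ->
    nr (f k n - f k.+1 n) <= 2 * 2^-1 ^+ k.
  have := nr_cls (bounded_seqB (fb k) (fb k.+1)).
  rewrite -clsB// !fE => /(_ _ (h0 k))[N NP].
  exists N => n /NP /le_trans; apply.
  by have := xc k; rewrite mul1r; lra.
have {close}/choice[N NP] := close.
pose good n k := all (fun i => N i <= n)%N (iota 0 k).
have good0 n : exists k, (k <= n)%N && good n k by exists 0%N.
pose kk n := ex_maxn (good0 n) (fun k (H : (k <= n)%N && good n k) => proj1 (andP H)).
have kkP n : good n (kk n) /\ forall k, (k <= n)%N -> good n k -> (k <= kk n)%N.
  rewrite /kk; case: ex_maxnP => k /andP[_ gk] kmax; split=> // k' k'n gk'.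
  by apply: kmax; rewrite k'n.
pose g n := f (kk n) n.
have tail k i n : good n (k + i)%N ->
    nr (f k n - f (k + i)%N n) <= 4 * 2^-1 ^+ k.
  move=> gi.
  suff : nr (f k n - f (k + i)%N n) <= 4 * (2^-1 ^+ k - 2^-1 ^+ (k + i)).
    by move/le_trans; apply; rewrite ler_pM2l// gerBl ltW.
  elim: i gi => [|i IH] gi; first by rewrite addn0 !subrr nr0 mulr0.
  have gi' : good n (k + i)%N.
    by move: gi; rewrite /good addnS -addn1 iotaD all_cat => /andP[].
  have Ni : (N (k + i) <= n)%N.
    by move: gi; rewrite /good addnS -addn1 iotaD all_cat => /andP[_ /andP[]].
  rewrite (le_trans (nr_triangle (f (k + i)%N n) _ _))//.
  have := NP _ _ Ni; have := IH gi'; rewrite -addnS (hS (k + i)%N) addnS; lra.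
have kkge k : exists n0, forall n, (n0 <= n)%N -> (k <= kk n)%N.
  exists (maxn k (\max_(i < k) N i)) => n; rewrite geq_max => /andP[kn Nn].
  have [_] := kkP n; apply => //; apply/allP => i; rewrite mem_iota add0n /= => ik.
  by rewrite (leq_trans _ Nn)// (leq_bigmax (F := fun i : 'I_k => N i) (Ordinal ik)).
have gk k : limsup_le (fun n => f k n - g n) (4 * 2^-1 ^+ k).
  have [n0 n0P] := kkge k; move=> e e0; exists n0 => n /n0P kn.
  have := @tail k (kk n - k)%N n; rewrite subnKC// => tn.
  by rewrite (le_trans (tn (proj1 (kkP n))))// lerDl ltW.
have gb : bounded_seq g.
  have [c0 c0P] := fb 0%N; exists (c0 + 4) => n.
  have := @tail 0%N (kk n) n; rewrite add0n => /(_ (proj1 (kkP n))) tn.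
  rewrite -(subrK (f 0%N n) (g n)) addrC (le_trans (nrD _ _))// lerD// nr_distC.
  by rewrite (le_trans tn)// expr0 mulr1.
exists (cls g) => e e0; have [k kP] := geometric_small 4 (half01 (R := R)) e0.
exists k => n kn; rewrite -fE clsB// (le_trans _ (ltW kP))//.
apply/nr_clsP; [exact: bounded_seqB|by rewrite mulr_ge0 ?ltW|].
apply: limsup_leW (gk n); rewrite ler_pM2l//.
by rewrite ler_wiXn2l ?invr_ge0// invf_le1 ?ler1n.
Qed.
HB.instance Definition _ := Uniform_isComplete.Build asymp asymp_complete.

Let mul (x y : asymp) : asymp := cls (fun n => rep x n ** rep y n).
Let star (x : asymp) : asymp := cls (fun n => (rep x n)^#).

Fact mul_cls f g : bounded_seq f -> bounded_seq g ->
  mul (cls f) (cls g) = cls (fun n => f n ** g n).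
Proof.
move=> fb gb; apply/cls_eqP; [by apply: bounded_seqM; exact: repP|exact: bounded_seqM|].
have [c fc] := fb; have c0 : 0 <= c := le_trans (nr_ge0 _) (fc 0%N).
have fc' : limsup_le f c.
  by move=> e e0; exists 0%N => n _; rewrite (le_trans (fc n))// lerDl ltW.
have := limsup_leD
  (limsup_leM (lexx 0) (limsup_nr_ge0 _) (rep_cls fb) (limsup_le_nr (repP (cls g))))
  (limsup_leM c0 (lexx 0) fc' (rep_cls gb)).
rewrite mul0r mulr0 addr0 => /limsup_le_eventually; apply; exists 0%N => n _.
by rewrite cmulBl cmulBr addrA subrK.
Qed.

Fact star_cls f : bounded_seq f -> star (cls f) = cls (fun n => (f n)^#).
Proof.
move=> fb; apply/cls_eqP; [exact/bounded_seqV/repP|exact: bounded_seqV|].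
apply: limsup_le_eventually (rep_cls fb) _; exists 0%N => n _.
by rewrite -adjB nr_adj.
Qed.

Fact asymp_mulA : associative mul.
Proof.
move=> x y z; rewrite -(repK x) -(repK y) -(repK z).
have xb := repP x; have yb := repP y; have zb := repP z.
rewrite !mul_cls; do ?[exact: bounded_seqM|done].
by congr cls; apply/funext => n; rewrite cmulA.
Qed.
Fact asymp_mulDl : left_distributive mul +%R.
Proof.
move=> x y z; rewrite -(repK x) -(repK y) -(repK z).
have xb := repP x; have yb := repP y; have zb := repP z.
rewrite clsD// !mul_cls ?clsD; do ?[exact: bounded_seqM|exact: bounded_seqD|done].
by congr cls; apply/funext => n; rewrite cmulDl.
Qed.
Fact asymp_mulDr : right_distributive mul +%R.
Proof.
move=> x y z; rewrite -(repK x) -(repK y) -(repK z).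
have xb := repP x; have yb := repP y; have zb := repP z.
rewrite clsD// !mul_cls ?clsD; do ?[exact: bounded_seqM|exact: bounded_seqD|done].
by congr cls; apply/funext => n; rewrite cmulDr.
Qed.
Fact asymp_mulZl (a : R[i]) x y : mul (a *: x) y = a *: mul x y.
Proof.
rewrite -(repK x) -(repK y); have xb := repP x; have yb := repP y.
rewrite clsZ// !mul_cls ?clsZ; do ?[exact: bounded_seqM|exact: bounded_seqZ|done].
by congr cls; apply/funext => n; rewrite cmulZl.
Qed.
Fact asymp_mulZr (a : R[i]) x y : mul x (a *: y) = a *: mul x y.
Proof.
rewrite -(repK x) -(repK y); have xb := repP x; have yb := repP y.
rewrite clsZ// !mul_cls ?clsZ; do ?[exact: bounded_seqM|exact: bounded_seqZ|done].
by congr cls; apply/funext => n; rewrite cmulZr.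
Qed.
Fact asymp_nrM x y : nr (mul x y) <= nr x * nr y.
Proof.
have xb := repP x; have yb := repP y.
apply/nr_clsP; [exact: bounded_seqM|by rewrite mulr_ge0 ?nr_ge0|].
by apply: limsup_leM; rewrite ?nr_ge0//; exact: limsup_le_nr.
Qed.
Fact asymp_normM x y : `|mul x y| <= `|x| * `|y|.
Proof. by rewrite !nrE -rmorphM /= lecR asymp_nrM. Qed.
Fact asymp_adjK : involutive star.
Proof.
move=> x; rewrite -(repK x) !star_cls; do ?[exact: repP|exact/bounded_seqV/repP].
by congr cls; apply/funext => n; rewrite adjK.
Qed.
Fact asymp_adjD : {morph star : x y / x + y}.
Proof.
move=> x y; rewrite -(repK x) -(repK y); have xb := repP x; have yb := repP y.
rewrite clsD// !star_cls ?clsD; do ?[exact: bounded_seqV|exact: bounded_seqD|done].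
by congr cls; apply/funext => n; rewrite adjD.
Qed.
Fact asymp_adjZ (a : R[i]) x : star (a *: x) = a^* *: star x.
Proof.
rewrite -(repK x); have xb := repP x.
rewrite clsZ// !star_cls ?clsZ; do ?[exact: bounded_seqV|exact: bounded_seqZ|done].
by congr cls; apply/funext => n; rewrite adjZ.
Qed.
Fact asymp_adjM x y : star (mul x y) = mul (star y) (star x).
Proof.
rewrite -(repK x) -(repK y); have xb := repP x; have yb := repP y.
rewrite mul_cls// !star_cls ?mul_cls; do ?[exact: bounded_seqV|exact: bounded_seqM|done].
by congr cls; apply/funext => n; rewrite adjM.
Qed.
Fact asymp_cstar x : `|mul (star x) x| = `|x| ^+ 2.
Proof.
have xb := repP x; rewrite !nrE -rmorphXn /=; congr (_%:C%C).
have sx : nr (star x) <= nr x.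
  apply/nr_clsP; rewrite ?nr_ge0//; first exact: bounded_seqV.
  apply: limsup_le_eventually (limsup_le_nr xb) _; exists 0%N => n _.
  by rewrite nr_adj.
apply/eqP; rewrite eq_le (le_trans (asymp_nrM _ _)) /=; last first.
  by rewrite expr2 ler_wpM2r ?nr_ge0.
rewrite -[leRHS]sqr_sqrtr ?nr_ge0// ler_sqr ?nnegrE ?nr_ge0 ?sqrtr_ge0//.
rewrite -{1}(repK x); apply/nr_clsP; rewrite ?sqrtr_ge0//.
apply: limsup_le_sqrt; rewrite ?nr_ge0//.
have -> : mul (star x) x = cls (fun n => (rep x n)^# ** rep x n).
  by rewrite -{2}(repK x) mul_cls//; exact: bounded_seqV.
by apply: nr_cls; apply: bounded_seqM => //; exact: bounded_seqV.
Qed.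

HB.instance Definition _ := isCstarAlgebra.Build R asymp
  asymp_mulA asymp_mulDl asymp_mulDr asymp_mulZl asymp_mulZr
  asymp_normM asymp_adjK asymp_adjD asymp_adjZ asymp_adjM asymp_cstar.

Lemma clsM f g : bounded_seq f -> bounded_seq g ->
  cls f ** cls g = cls (fun n => f n ** g n).
Proof. exact: mul_cls. Qed.

Lemma clsV f : bounded_seq f -> (cls f)^# = cls (fun n => (f n)^#).
Proof. exact: star_cls. Qed.

Lemma bounded_cst (a : A) : bounded_seq (fun _ => a).
Proof. by exists (nr a). Qed.

Let one : asymp := cls (fun _ => cone).
Fact asymp_mul1 : left_id one cmul.
Proof.
move=> x; rewrite -(repK x) clsM; [|exact: bounded_cst|exact: repP].
by congr cls; apply/funext => n; rewrite cmul1.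
Qed.
Fact asymp_mulr1 : right_id one cmul.
Proof.
move=> x; rewrite -(repK x) clsM; [|exact: repP|exact: bounded_cst].
by congr cls; apply/funext => n; rewrite cmulr1.
Qed.
HB.instance Definition _ := hasCstarUnit.Build R asymp asymp_mul1 asymp_mulr1.

Lemma cls1 : cls (fun _ => cone) = cone :> asymp.
Proof. by []. Qed.

Lemma nr_cls_cst f (c : R) : (forall n, nr (f n) = c) -> nr (cls f) = c.
Proof.
move=> fc; have fb : bounded_seq f by exists c => n; rewrite fc.
have c0 : 0 <= c by rewrite -(fc 0%N) nr_ge0.
apply/eqP; rewrite eq_le; apply/andP; split.
  by apply/nr_clsP => // e e0; exists 0%N => n _; rewrite fc lerDl ltW.
apply/ler_addgt0Pr => e e0; have [n0 n0P] := nr_cls fb e0.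
by rewrite -(fc n0) n0P.
Qed.

End AsymptoticAlgebra.

(** * Generated subalgebras, isomorphisms and isometries *)

Section StarHomTools.
Context {R : realType}.
Implicit Types A B C : cstarAlgType R.

Lemma star_hom_comp A B C (g : B -> C) (f : A -> B) :
  star_hom g -> star_hom f -> star_hom (g \o f).
Proof.
move=> gh fh; split=> [a x y|x y|x] /=.
- by rewrite star_homL// star_homL.
- by rewrite star_homM// star_homM.
- by rewrite star_homV// star_homV.
Qed.

Lemma cstar_generatedP A (X : set A) : cstar_subalgebra (cstar_generated X).
Proof.
split.
  by apply: closed_bigI => E [[cE _] _].
split.
- by move=> E [[_ []]].
- by move=> x y xX yX E EX; have [[_ [_ ED _ _ _]] _] := EX; apply: ED; [exact: xX|exact: yX].
- by move=> a x xX E EX; have [[_ [_ _ EZ _ _]] _] := EX; apply: EZ; exact: xX.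
- by move=> x y xX yX E EX; have [[_ [_ _ _ EM _]] _] := EX; apply: EM; [exact: xX|exact: yX].
- by move=> x xX E EX; have [[_ [_ _ _ _ EV]] _] := EX; apply: EV; exact: xX.
Qed.

Lemma sub_cstar_generated A (X : set A) : X `<=` cstar_generated X.
Proof. by move=> x Xx E [_]; exact. Qed.

Lemma cstar_generated_min A (X E : set A) :
  cstar_subalgebra E -> X `<=` E -> cstar_generated X `<=` E.
Proof. by move=> cE XE x; apply. Qed.

Lemma preim_cstar_subalgebra A B (f : A -> B) (E : set B) :
  star_hom f -> cstar_subalgebra E -> cstar_subalgebra (f @^-1` E).
Proof.
move=> fh [cE [E0 ED EZ EM EV]]; split.
  exact: closed_preim_lip (lipschitz_star_hom fh) cE.
split=> [|x y|a x|x y|x] /=; rewrite ?star_hom0 ?star_homD ?star_homZ ?star_homM ?star_homV//.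
- exact: ED.
- exact: EZ.
- exact: EM.
- exact: EV.
Qed.

Lemma equalizer_cstar_subalgebra A B (f g : A -> B) :
  star_hom f -> star_hom g -> cstar_subalgebra [set x | f x = g x].
Proof.
move=> fh gh; split.
  exact: closed_eq_lip (lipschitz_star_hom fh) (lipschitz_star_hom gh).
split=> [|x y|a x|x y|x] /=.
- by rewrite !star_hom0.
- by rewrite !star_homD// => -> ->.
- by rewrite !star_homZ// => ->.
- by rewrite !star_homM// => -> ->.
- by rewrite !star_homV// => ->.
Qed.

Lemma star_hom_eq_generated A B (X : set A) (f g : A -> B) :
  cstar_generated X = setT -> star_hom f -> star_hom g ->
  (forall x, X x -> f x = g x) -> f =1 g.
Proof.
move=> genX fh gh fgX x; have : [set: A] x by [].
rewrite -genX => xX.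
exact: cstar_generated_min (equalizer_cstar_subalgebra fh gh) fgX _ xX.
Qed.

Lemma image_subval_cstar_subalgebra A (E : set A) (cE : cstar_subalgebra E)
    (F : set (subcstar cE)) :
  cstar_subalgebra F -> cstar_subalgebra (@subval R A E cE @` F).
Proof.
move=> [cF [F0 FD FZ FM FV]]; have vh := subval_hom cE; split.
  apply/closed_nrP => x xF.
  have Ex : E x.
    have [clE _] := cE; move/closed_nrP : (clE); apply => e /xF[_ [y _ <-] xy].
    by exists (subval y) => //; exact: subvalP.
  exists (subcorestr cE x); last by rewrite subcorestrK.
  move/closed_nrP : cF; apply => e /xF[_ [y Fy <-] xy]; exists y => //.
  by rewrite nr_subcstar -/(subval _) (star_homB vh) subcorestrK.
split=> [|_ _ [x Fx <-] [y Fy <-]|a _ [x Fx <-]|_ _ [x Fx <-] [y Fy <-]|_ [x Fx <-]].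
- by exists 0 => //; rewrite (star_hom0 vh).
- by exists (x + y); [exact: FD|rewrite (star_homD vh)].
- by exists (a *: x); [exact: FZ|rewrite (star_homZ vh)].
- by exists (x ** y); [exact: FM|rewrite (star_homM vh)].
- by exists (x^#); [exact: FV|rewrite (star_homV vh)].
Qed.

(** A set of generators also generates the subalgebra regarded as an algebra,
    because being closed in the subalgebra and in the ambient algebra agree. *)
Lemma subcstar_generated A (X : set A)
    (cE : cstar_subalgebra (cstar_generated X)) B (f g : subcstar cE -> B) :
  star_hom f -> star_hom g ->
  (forall x, X (subval x) -> f x = g x) -> f =1 g.
Proof.
move=> fh gh fgX x.
have : (@subval R A _ cE @` [set x | f x = g x]) (subval x).
  apply: cstar_generated_min _ _ _ (subvalP x).
    exact/image_subval_cstar_subalgebra/equalizer_cstar_subalgebra.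
  move=> y Xy; have Ey := sub_cstar_generated Xy.
  exists (subcorestr cE y); last by rewrite subcorestrK.
  by apply: fgX; rewrite subcorestrK.
by case=> y fgy /subval_inj <-.
Qed.

Lemma star_iso_inv A B (E : set B) (cE : cstar_subalgebra E) (f : A -> B) :
  star_iso_onto f E -> exists g : subcstar cE -> A,
    [/\ star_hom g, forall y, f (g y) = subval y &
        forall x, g (subcorestr cE (f x)) = x].
Proof.
move=> [fh [fE finj fsurj]].
have {}finj : injective f by move=> x y; apply: finj; rewrite inE.
have /choice[g gP] (y : subcstar cE) : exists x, f x = subval y.
  by have [x _ xy] := fsurj _ (subvalP y); exists x.
have vh := subval_hom cE.
exists g; split=> [|//|x].
- split=> [a x y|x y|x]; apply: finj; rewrite gP.
  + by rewrite (star_homL vh) star_homL// !gP.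
  + by rewrite (star_homM vh) star_homM// !gP.
  + by rewrite (star_homV vh) star_homV// !gP.
- by apply: finj; rewrite gP subcorestrK//; exact: fE.
Qed.

(** The inverse is defined on a closed subalgebra, hence on a C*-algebra, so that
    it is contractive as well. *)
Lemma star_iso_isometric A B (E : set B) (cE : cstar_subalgebra E) (f : A -> B) :
  star_iso_onto f E -> forall x, nr (f x) = nr x.
Proof.
move=> fi; have [g [gh fg gf]] := star_iso_inv cE fi; have [fh [fE _ _]] := fi.
move=> x; apply/eqP; rewrite eq_le star_hom_contractive//=.
rewrite -{1}(gf x) (le_trans (star_hom_contractive gh _))//.
by rewrite nr_subcstar -/(subval _) subcorestrK//; exact: fE.
Qed.

End StarHomTools.

Section Unital.
Context {R : realType}.
Variable A : unitalCstarAlgType R.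
Implicit Types x v w : A.

Lemma adj1 : (cone : A)^# = cone.
Proof. by rewrite -[LHS]cmulr1 -{2}(adjK cone) -adjM cmulr1 adjK. Qed.

Lemma nr1_le1 : nr (cone : A) <= 1.
Proof.
have [->|n0] := eqVneq (nr (cone : A)) 0; first exact: ler01.
rewrite -(@ler_pM2l _ (nr (cone : A))) ?lt_def ?n0 ?nr_ge0// mulr1 -expr2.
by rewrite -nr_adjM adj1 cmul1.
Qed.

Lemma nr_isometry v : isometry v -> nr v <= 1.
Proof.
move=> vi; rewrite -ler_sqr ?nnegrE ?nr_ge0// -nr_adjM vi expr1n.
exact: nr1_le1.
Qed.

Lemma isometryK v x : isometry v -> v^# ** (v ** x) = x.
Proof. by move=> vi; rewrite cmulA vi cmul1. Qed.

Lemma conj_isometry_hom v : isometry v -> star_hom (fun x => v ** x ** v^#).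
Proof.
move=> vi; split=> [a x y|x y|x].
- by rewrite cmulDr cmulDl cmulZr cmulZl.
- by rewrite -!cmulA isometryK.
- by rewrite !adjM adjK cmulA.
Qed.

Lemma nr_conj_isometry v x : isometry v -> nr (v ** x ** v^#) = nr x.
Proof.
move=> vi; apply/eqP; rewrite eq_le; apply/andP; split.
  exact: star_hom_contractive (conj_isometry_hom vi) x.
have {1}-> : x = v^# ** (v ** x ** v^#) ** v by rewrite -!cmulA vi cmulr1 isometryK.
rewrite (le_trans (nr_mul _ _))// -[leRHS]mulr1 ler_pM ?nr_ge0 ?nr_isometry//.
rewrite (le_trans (nr_mul _ _))// nr_adj -[leRHS]mul1r ler_wpM2r ?nr_ge0//.
exact: nr_isometry.
Qed.

Lemma isometry_mul v w : isometry v -> isometry w -> isometry (v ** w).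
Proof. by move=> vi wi; rewrite /isometry adjM -cmulA isometryK. Qed.

(** Such a [v] is the image of an identity element under a multiplicative map. *)
Lemma isometry_idem v : isometry v -> v ** v = v -> v = cone.
Proof. by move=> vi vv; rewrite -vi -[X in _ ** X]vv isometryK. Qed.

Lemma cpowD x n m : x ^^ (n + m) = x ^^ n ** x ^^ m.
Proof. by elim: n => [|n IH] /=; rewrite ?cmul1// IH cmulA. Qed.

Lemma cpow1 x : x ^^ 1 = x.
Proof. by rewrite /= cmulr1. Qed.

Lemma cpowSr x n : x ^^ n.+1 = x ^^ n ** x.
Proof. by rewrite -addn1 cpowD cpow1. Qed.

Lemma adj_cpow x n : (x ^^ n)^# = (x^#) ^^ n.
Proof. by elim: n => [|n IH]; rewrite ?adj1// cpowSr adjM IH. Qed.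

Lemma isometry_cpow v n : isometry v -> isometry (v ^^ n).
Proof.
move=> vi; elim: n => [|n IH] /=; last exact: isometry_mul.
by rewrite /isometry adj1 cmul1.
Qed.

End Unital.

(** * The universal algebra as a semigroup crossed product *)

Section SemigroupIsometries.
Context {R : realType} {G : groupType} {phi : {multiplicative G -> G}}.
Local Notation S := (semidirect_nat phi).

Lemma sdnM g n h m :
  (((g, n) : S) * ((h, m) : S))%g = (g * endo_pow phi n h, (n + m)%N)%g :> S.
Proof. by []. Qed.

Variable A : unitalCstarAlgType R.
Variable v : S -> A.
Hypothesis v_isometry : forall p, isometry (v p).
Hypothesis vM : forall p q, v (p * q)%g = v p ** v q.

Let u (g : G) : A := v (g, 0%N).
Let s : A := v (1%g, 1%N).

Lemma isorep1 : v 1%g = cone.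
Proof. by apply: isometry_idem => //; rewrite -vM mulg1. Qed.

Lemma isorepX n : v (1%g, n) = s ^^ n.
Proof.
elim: n => [|n IH]; first exact: isorep1.
by rewrite /= -IH -vM sdnM endo_pow1 mulg1.
Qed.

Lemma isorepE g n : v (g, n) = u g ** s ^^ n.
Proof. by rewrite -isorepX -vM sdnM mulg1. Qed.

Lemma isorepVr g : u g ** u (g^-1)%g = cone.
Proof. by rewrite -vM sdnM mulgV -isorep1. Qed.

Lemma isorepV g : (u g)^# = u (g^-1)%g.
Proof. by rewrite -[RHS](isometryK _ (v_isometry (g, 0%N))) -/(u g) isorepVr cmulr1. Qed.

Lemma isorep_adj g n : (v (g, n))^# = s^# ^^ n ** u (g^-1)%g.
Proof. by rewrite isorepE adjM adj_cpow isorepV. Qed.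

Lemma isorep_comm n g : s ^^ n ** u g = u (endo_pow phi n g) ** s ^^ n.
Proof. by rewrite -isorepX -!vM !sdnM mul1g mulg1 addn0. Qed.

End SemigroupIsometries.

Section UBFacts.
Context {R : realType} {G : groupType}.
Variables (phi : {multiplicative G -> G}) (B : set (set G)).
Variables (A : unitalCstarAlgType R) (e : set G -> A) (u : G -> A) (s : A).
Hypothesis rel : UB_relations phi B e u s.
Local Notation S := (semidirect_nat phi).

Lemma ltranslate1 (X : set G) : ltranslate 1%g X = X.
Proof. by rewrite /ltranslate; under eq_imagel do rewrite mul1g; rewrite image_id. Qed.

Definition UBrep (p : S) : A := u p.1 ** s ^^ p.2.

Lemma UBrepM p q : UBrep (p * q)%g = UBrep p ** UBrep q.
Proof. by case: p q => [g n] [h m]; rewrite /UBrep sdnM -(UB_mul rel) !cmulA. Qed.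

Lemma UBrep_isometry p : isometry (UBrep p).
Proof.
apply: isometry_mul; first by case: (UB_unitary rel p.1).
exact: isometry_cpow (UB_isometry rel).
Qed.

Lemma UB_u1 : u 1%g = cone.
Proof. by rewrite -[LHS]cmulr1; exact: isorep1 UBrep_isometry UBrepM. Qed.

Lemma UBrep_g g : UBrep (g, 0%N) = u g. Proof. exact: cmulr1. Qed.

Lemma UBrep_s : UBrep (1%g, 1%N) = s.
Proof. by rewrite /UBrep UB_u1 cmul1 cpow1. Qed.

Lemma UBrep_conj g n x :
  u g ** s ^^ n ** x ** s^# ^^ n ** u (g^-1)%g = UBrep (g, n) ** x ** (UBrep (g, n))^#.
Proof.
rewrite (isorep_adj UBrep_isometry UBrepM) UBrep_s UBrep_g /UBrep /=.
by rewrite !cmulA.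
Qed.

Let DBs := DB B e u s.

Lemma DB_subalgebra : cstar_subalgebra DBs.
Proof. exact: cstar_generatedP. Qed.

Lemma DB_conj p x : DBs x -> DBs (UBrep p ** x ** (UBrep p)^#).
Proof.
have wh := conj_isometry_hom (UBrep_isometry p).
suff : DBs `<=` (fun x => UBrep p ** x ** (UBrep p)^#) @^-1` DBs by apply.
apply: cstar_generated_min; first exact: preim_cstar_subalgebra wh DB_subalgebra.
move=> _ [g [n [H [BH ->]]]]; apply: sub_cstar_generated.
exists (p * (g, n) : S)%g.1, (p * (g, n) : S)%g.2, H; split=> //.
rewrite !UBrep_conj -surjective_pairing UBrepM adjM.
by rewrite !cmulA.
Qed.

Hypothesis B_setT : B [set: G].

Lemma constructible_base H : B H -> constructible phi B H.
Proof. by move=> BH C [_]; exact. Qed.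

Lemma constructibleP : constructible_closed phi (constructible phi B).
Proof.
split.
- by move=> X Y cX cY C CC; have [[CU _ _ _ _] _] := CC; apply: CU; [exact: cX|exact: cY].
- by move=> X Y cX cY C CC; have [[_ CI _ _ _] _] := CC; apply: CI; [exact: cX|exact: cY].
- by move=> X cX C CC; have [[_ _ CC' _ _] _] := CC; apply: CC'; exact: cX.
- by move=> X cX C CC; have [[_ _ _ Cp _] _] := CC; apply: Cp; exact: cX.
- by move=> g X cX C CC; have [[_ _ _ _ Ct] _] := CC; apply: Ct; exact: cX.
Qed.

Lemma constructible_shift g n X :
  constructible phi B X -> constructible phi B (ltranslate g (endo_pow phi n @` X)).
Proof.
have [_ _ _ Cp Ct] := constructibleP; move=> cX; apply: Ct.
elim: n => [|n IH]; first by rewrite (_ : endo_pow phi 0 = id) ?image_id.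
have -> : endo_pow phi n.+1 @` X = phi @` (endo_pow phi n @` X).
  by rewrite image_comp; apply: eq_imagel.
exact: Cp.
Qed.

Lemma constructible_setT : constructible phi B [set: G].
Proof. exact: constructible_base. Qed.

Lemma constructible_set0 : constructible phi B set0.
Proof.
have [_ _ Cc _ _] := constructibleP.
rewrite -setCT; apply: Cc; exact: constructible_setT.
Qed.

(** The subalgebra [D] contains the projections of all constructible sets,
    although it is generated by those of the translates of [phi^n (H)],
    [H \in B]: intersections are products, complements are differences with
    the unit, and [D] is invariant under the semigroup. *)
Lemma DB_constructible X : constructible phi B X -> DBs (e X).
Proof.
pose Q X := constructible phi B X /\ DBs (e X).
suff : constructible phi B `<=` Q by move=> + cX => /(_ _ cX)[].
have [CU CI Cc Cp Ct] := constructibleP.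
have [_ [D0 DD DZ DM DV]] := DB_subalgebra.
have DN x : DBs x -> DBs (- x) by move=> Dx; rewrite -scaleN1r; exact: DZ.
have QB : B `<=` Q.
  move=> H BH; split; first exact: constructible_base.
  apply: sub_cstar_generated; exists 1%g, 0%N, H; split=> //.
  by rewrite UBrep_conj UBrep_g UB_u1 adj1 cmul1 cmulr1.
have eT := UB_setT rel; have e0 := UB_set0 rel.
have QI X1 X2 : Q X1 -> Q X2 -> Q (X1 `&` X2).
  move=> [c1 d1] [c2 d2]; split; first exact: CI.
  by rewrite -(UB_setI rel)//; exact: DM.
have Qshift g n X1 : Q X1 -> Q (ltranslate g (endo_pow phi n @` X1)).
  move=> [c1 d1]; split; first exact: constructible_shift.
  by rewrite -(UB_conj rel)// UBrep_conj; exact: DB_conj.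
move=> X1; apply; split=> //; split=> //.
- move=> X2 X3 Q2 Q3; have [c2 d2] := Q2; have [c3 d3] := Q3.
  split; first exact: CU.
  have := UB_setU rel c2 c3; move/eqP; rewrite -subr_eq => /eqP <-.
  by apply: (DD); [exact: DD|apply: DN; have [] := QI _ _ Q2 Q3].
- move=> X2 [c2 d2]; split; first exact: Cc.
  have := UB_setU rel c2 (Cc _ c2); rewrite setUv setICr eT e0 addr0 => eC.
  rewrite (_ : e (~` X2) = - e X2 + cone); last by rewrite -eC addKr.
  apply: DD; first exact: DN.
  by rewrite -eT; have [] := QB _ B_setT.
- move=> X2 Q2; have := Qshift 1%g 1%N _ Q2.
  by rewrite ltranslate1 (_ : endo_pow phi 1 = phi).
- move=> g X2 Q2; have := Qshift g 0%N _ Q2.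
  by rewrite (_ : endo_pow phi 0 = id) ?image_id.
Qed.

Lemma DB1 : DBs cone.
Proof. by rewrite -(UB_setT rel); exact: DB_constructible constructible_setT. Qed.

End UBFacts.

Section UBCrossedProduct.
Context {R : realType} {G : groupType}.
Variables (phi : {multiplicative G -> G}) (B : set (set G)).
Hypothesis B_setT : B [set: G].
Variables (U : unitalCstarAlgType R) (e : set G -> U) (u : G -> U) (s : U).
Hypothesis U_univ : is_UB phi B e u s.
Variables (D : unitalCstarAlgType R) (incl : D -> U).
Hypothesis D_incl : star_iso_onto incl (DB B e u s).
Variable alpha : semidirect_nat phi -> D -> D.
Hypothesis alphaE : forall g n x,
  incl (alpha (g, n) x) = u g ** s ^^ n ** incl x ** s^# ^^ n ** u (g^-1)%g.
Variables (C : unitalCstarAlgType R) (iD : D -> C) (iS : semidirect_nat phi -> C).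
Hypothesis C_univ : is_semigroup_crossed_product alpha iD iS.

Local Notation S := (semidirect_nat phi).
Let rel := is_UB_relations U_univ.
Let cov := scp_covariant C_univ.
Let w : S -> U := UBrep u s.

Let incl_hom : star_hom incl. Proof. by case: D_incl. Qed.
Let iD_hom : star_hom iD. Proof. exact: sc_hom cov. Qed.
Let incl_inj : injective incl.
Proof. by have [_ [_ incl_inj _]] := D_incl => x y; apply: incl_inj; rewrite inE. Qed.
Let incl_surj y : DB B e u s y -> exists x, incl x = y.
Proof. by have [_ [_ _ incl_s]] := D_incl; move=> /incl_s[x _ xy]; exists x. Qed.

Let incl1 : incl cone = cone.
Proof.
have [t t1] := incl_surj (DB1 rel B_setT).
by rewrite -[LHS]cmulr1 -t1 -(star_homM incl_hom) cmul1 t1.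
Qed.

Let alpha_w p x : incl (alpha p x) = w p ** incl x ** (w p)^#.
Proof. by case: p => g n; rewrite alphaE (UBrep_conj rel). Qed.

Lemma U_covariant : semigroup_covariant alpha incl w.
Proof.
split=> //.
- exact: UBrep_isometry rel.
- exact: UBrepM rel.
Qed.

Definition dproj (X : set G) : D := xget 0 [set x | incl x = e X].

Lemma dprojP X : constructible phi B X -> incl (dproj X) = e X.
Proof.
move=> cX; have [x xP] := incl_surj (DB_constructible rel B_setT cX).
exact: (xgetPex 0 (ex_intro [set x | incl x = e X] x xP)).
Qed.

(** The projections [e X] lie in [D], so they have images in [C] which satisfy
    the lattice relations; the relations with [u] and [s] are covariance. *)
Lemma C_UB_relations : UB_relations phi B (fun X => iD (dproj X))
  (fun g => iS (g, 0%N)) (iS (1%g, 1%N)).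
Proof.
have iso := sc_isometry cov; have iSM := sc_mul cov.
have [CU CI _ _ _] := @constructibleP _ phi B.
have shift := @constructible_shift _ phi B.
split.
- move=> X cX; have [ee es] := UB_projection rel cX; split.
    rewrite -star_homM//; congr iD; apply: incl_inj.
    by rewrite star_homM// dprojP.
  by rewrite -star_homV//; congr iD; apply: incl_inj; rewrite star_homV// dprojP.
- move=> g; split; first exact: iso.
  by rewrite (isorepV iso iSM) (isorepVr iso iSM).
- exact: iso.
- by move=> g h n m; rewrite -(isorepE iso iSM) -cmulA -!(isorepE iso iSM) -iSM.
- move=> g n X cX; rewrite -(isorepE iso iSM) -!cmulA -(isorep_adj iso iSM) cmulA.
  rewrite (sc_covariance cov); congr iD; apply: incl_inj.
  rewrite alpha_w !dprojP//; last exact: shift.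
  by rewrite -(UB_conj rel)// (UBrep_conj rel).
- rewrite -(sc_unital cov); congr iD; apply: incl_inj.
  by rewrite incl1 dprojP ?(UB_setT rel)//; exact: constructible_setT.
- rewrite -(star_hom0 iD_hom); congr iD; apply: incl_inj.
  by rewrite star_hom0// dprojP ?(UB_set0 rel)//; exact: constructible_set0.
- move=> X Y cX cY; rewrite -star_homM//; congr iD; apply: incl_inj.
  by rewrite star_homM// !dprojP// ?(UB_setI rel)//; exact: CI.
- move=> X Y cX cY; rewrite -!star_homD//; congr iD; apply: incl_inj.
  rewrite !star_homD// !dprojP//; [|exact: CI|exact: CU].
  exact: UB_setU rel _ _ cX cY.
Qed.

(** One composite of the two maps given by the universal properties is the
    identity by uniqueness.  For the other, uniqueness asks for agreement with
    [iD] on all of [D], and the maps are known only on the generators of [D];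
    continuity of *-homomorphisms fills the gap. *)
Theorem UB_iso_crossed_product :
  exists2 Phi : U -> C, star_iso_onto Phi [set: C] &
    forall x, Phi (incl x) = iD x.
Proof.
have [f [[fh fe fu fs] _]] := is_UB_universal U_univ C_UB_relations.
have [h [[hh hD hS] _]] := scp_universal C_univ U_covariant.
have iso := sc_isometry cov; have iSM := sc_mul cov.
have fincl x : f (incl x) = iD x.
  have cDB := DB_subalgebra B e u s.
  have [g [gh gP gK]] := star_iso_inv cDB D_incl.
  have vh := subval_hom cDB.
  have key : f \o @subval R U _ cDB =1 iD \o g.
    apply: subcstar_generated; try exact: star_hom_comp.
    move=> y [k [n [H [BH yE]]]] /=.
    pose X := ltranslate k (endo_pow phi n @` H).
    have cH : constructible phi B H := @constructible_base _ phi B H BH.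
    have cX : constructible phi B X by exact: constructible_shift.
    have yX : subval y = e X by rewrite yE (UB_conj rel).
    rewrite yX fe//; congr iD; apply: incl_inj.
    by rewrite dprojP// gP.
  have := key (subcorestr cDB (incl x)); rewrite /= gK => <-.
  by rewrite subcorestrK//; have [_ [inclE _ _]] := D_incl; exact: inclE.
have hf : h \o f =1 id.
  have [k [_ kP]] := is_UB_universal U_univ rel.
  have <- : k = h \o f.
    apply: kP; split=> [|X cX|g|] /=.
    - exact: star_hom_comp.
    - by rewrite fe// hD dprojP.
    - by rewrite fu hS /w UBrep_g.
    - by rewrite fs hS /w (UBrep_s rel).
  by move=> x; rewrite (kP id).
have fh' : f \o h =1 id.
  have [k [_ kP]] := scp_universal C_univ cov.
  have <- : k = f \o h.
    apply: kP; split=> [|x|[g n]] /=.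
    - exact: star_hom_comp.
    - by rewrite hD fincl.
    - rewrite hS /w /UBrep star_homM// fu [RHS](isorepE iso iSM); congr (_ ** _).
      elim: n => [|n IH] /=; last by rewrite star_homM// fs IH.
      rewrite -(UB_u1 rel) fu; exact: isorep1 iso iSM.
  by move=> x; rewrite (kP id).
exists f => //; split=> //; split=> //.
- by move=> x y _ _ xy; rewrite -(hf x) -(hf y) /= xy.
- by move=> y _; exists (h y) => //; rewrite -[RHS](fh' y).
Qed.

(** [incl] is isometric and factors through [iD] by a contractive map. *)
Lemma iD_isometric x : nr (iD x) = nr x.
Proof.
have [h [[hh hD hS] _]] := scp_universal C_univ U_covariant.
apply/eqP; rewrite eq_le star_hom_contractive//=.
rewrite -(star_iso_isometric (DB_subalgebra B e u s) D_incl) -hD.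
exact: star_hom_contractive.
Qed.

End UBCrossedProduct.

(** * Ranges, corners and covariant representations *)

Section IsometricRange.
Context {R : realType}.
Implicit Types A B : cstarAlgType R.

Lemma isometric_injective A B (f : A -> B) :
  star_hom f -> (forall x, nr (f x) = nr x) -> injective f.
Proof.
move=> fh fi x y xy; apply/eqP; rewrite -subr_eq0; apply/eqP/nr_eq0.
by rewrite -fi star_homB// xy subrr nr0.
Qed.

Lemma closed_range_isometric A B (f : A -> B) :
  star_hom f -> (forall x, nr (f x) = nr x) -> closed (range f).
Proof.
move=> fh fi; apply/closed_nrP => y yf.
have h0 n : 0 < 2^-1 ^+ n :> R by rewrite exprn_gt0// invr_gt0.
have /choice[x xP] n : exists x, nr (y - f x) < 2^-1 ^+ n.
  by have [_ [x _ <-] xy] := yf _ (h0 n); exists x.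
have xc : geometric_cauchy 2^-1 2 x.
  move=> n; rewrite -fi star_homB// (le_trans (nr_triangle y _ _))//.
  rewrite [nr (f _ - y)]nr_distC; have := xP n; have := xP n.+1.
  by have := h0 n; rewrite exprS; lra.
have [l lP] := geometric_cauchy_lim (half01 (R := R)) (ler0n R 2) xc.
exists l => //; apply/eqP; rewrite -subr_eq0; apply/eqP/nr_eq0/eqP.
rewrite eq_le nr_ge0 andbT; apply/ler_addgt0Pr => e e0; rewrite add0r.
have [n nP] := geometric_small (2 / (1 - 2^-1) + 1) (half01 (R := R)) e0.
rewrite (le_trans (nr_triangle (f (x n)) _ _))//.
rewrite -star_homB// fi [nr (f (x n) - y)]nr_distC [nr (l - _)]nr_distC.
rewrite (le_trans (lerD (lP n) (ltW (xP n))))//.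
by rewrite -[X in _ + X]mul1r -mulrDl ltW.
Qed.

Lemma inv_star_hom A B (f : A -> B) (g : B -> A) :
  star_hom f -> injective f -> (forall y, f (g y) = y) -> star_hom g.
Proof.
move=> fh fi fg; split=> [a x y|x y|x]; apply: fi; rewrite fg.
- by rewrite star_homL// !fg.
- by rewrite star_homM// !fg.
- by rewrite star_homV// !fg.
Qed.

(** The joint operations are extended to the closure one argument at a time. *)
Lemma closure_cstar_subalgebra A (E : set A) :
  E 0 -> (forall x y, E x -> E y -> E (x + y)) ->
  (forall (a : R[i]) x, E x -> E (a *: x)) ->
  (forall x y, E x -> E y -> E (x ** y)) -> (forall x, E x -> E x^#) ->
  cstar_subalgebra (closure E).
Proof.
move=> E0 ED EZ EM EV.
have cl := @closed_closure A E; split=> //.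
have sub : E `<=` closure E by exact: subset_closure.
have ext (f : A -> A) (F : set A) : closed F -> lipschitz_map f ->
    (forall x, E x -> F (f x)) -> forall x, closure E x -> F (f x).
  move=> cF fl fE x /closure_nrP xE; have := closed_preim_lip fl cF.
  by move=> /closed_nrP; apply => e /xE[y Ey xy]; exists y => //; exact: fE.
have lipD (c : A) : lipschitz_map (fun x => x + c).
  by exists 1 => // x y; rewrite opprD addrACA subrr addr0 mul1r.
split=> [|x y xE yE|a|x y xE yE|].
- exact: sub.
- apply: (ext (fun x => x + y)) xE => // x' Ex'.
  rewrite addrC; apply: (ext (fun y => y + x')) yE => // y' Ey'.
  by apply: sub; exact: ED.
- apply: ext => //; last by move=> x Ex; exact/sub/EZ.
  exists (cabs a + 1) => [|x y]; first by rewrite ltr_wpDl ?cabs_ge0.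
  by rewrite -scalerBr nrZ ler_wpM2r ?nr_ge0// lerDl.
- apply: (ext (fun x => x ** y)) xE => //; first exact: lipschitz_cmulr.
  move=> x' Ex'; apply: (ext (fun y => x' ** y)) yE => //.
    exact: lipschitz_cmull.
  by move=> y' Ey'; apply: sub; exact: EM.
- apply: ext => //; first exact: lipschitz_adj.
  by move=> x Ex; exact/sub/EV.
Qed.

End IsometricRange.

Section Corner.
Context {R : realType}.
Variables (A : cstarAlgType R) (q : A).
Hypothesis q_proj : projection q.

Lemma cornerP x : corner q x <-> q ** x ** q = x.
Proof.
have [qq _] := q_proj; split=> [[y _ <-]|xq]; last by exists x.
by rewrite !cmulA qq -!cmulA qq.
Qed.

Lemma corner_l x : corner q x -> q ** x = x.
Proof. by have [qq _] := q_proj => -[y _ <-]; rewrite !cmulA qq. Qed.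

Lemma corner_r x : corner q x -> x ** q = x.
Proof. by have [qq _] := q_proj => -[y _ <-]; rewrite -!cmulA qq. Qed.

Lemma corner_mem x : q ** x = x -> x ** q = x -> corner q x.
Proof. by move=> qx xq; apply/cornerP; rewrite qx xq. Qed.

Lemma corner_subalgebra : cstar_subalgebra (corner q).
Proof.
have [qq qs] := q_proj; split.
  rewrite (_ : corner q = [set x | q ** x ** q = x]); last first.
    by apply/seteqP; split=> x /cornerP.
  apply: closed_eq_lip (lipschitz_id _).
  exact: lipschitz_comp (lipschitz_cmulr q) (lipschitz_cmull q).
split=> [|x y xq yq|a x xq|x y xq yq|x xq]; apply: corner_mem.
- by rewrite cmul0r.
- by rewrite cmul0l.
- by rewrite cmulDr !corner_l.
- by rewrite cmulDl !corner_r.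
- by rewrite cmulZr corner_l.
- by rewrite cmulZl corner_r.
- by rewrite cmulA corner_l.
- by rewrite -cmulA corner_r.
- by rewrite -{1}qs -adjM corner_r.
- by rewrite -{1}qs -adjM corner_l.
Qed.

Definition corner_unit : unit_of (corner q) :=
  UnitOf (corner_mem (proj1 q_proj) (proj1 q_proj)) corner_l corner_r.

Definition corner_alg := unital_subcstar corner_subalgebra corner_unit.

End Corner.

Lemma sdzM (G : groupType) (phi : {multiplicative G -> G})
    (X Y : group_lim phi) (z w : int) :
  (((X, z) : semidirect_int phi) * ((Y, w) : semidirect_int phi))%g
    = (X * lim_phiz z Y, z + w)%g :> semidirect_int phi.
Proof. by []. Qed.

(** Negative powers of an isometry are those of its adjoint, so exponents add up
    only in the presence of the range projection. *)
Definition isometry_zpow (R : realType) (A : unitalCstarAlgType R) (s : A)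
    (z : int) : A :=
  match z with Posz n => s ^^ n | Negz n => s^# ^^ n.+1 end.

Section CrossedProductRep.
Context {R : realType} {G : groupType} {phi : {multiplicative G -> G}}.
Local Notation T := (semidirect_int phi).
Variables (L : cstarAlgType R) (act : T -> L -> L).
Hypothesis act_action : star_action act.
Variable M : unitalCstarAlgType R.
Variables (theta : L -> M) (gamma : group_lim phi -> M) (s : M).
Hypothesis theta_hom : star_hom theta.
Hypothesis gamma_isometry : forall X, isometry (gamma X).
Hypothesis gammaM : forall X Y, gamma (X * Y)%g = gamma X ** gamma Y.
Hypothesis s_isometry : isometry s.
Hypothesis s_gamma : forall X, s ** gamma X = gamma (lim_phi X) ** s.
Hypothesis gamma_theta : forall X a,
  gamma X ** theta a ** (gamma X)^# = theta (act (X, 0) a).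
Hypothesis s_theta : forall a, s ** theta a ** s^# = theta (act (1%g, 1) a).

Let actM g h a : act (g * h)%g a = act g (act h a).
Proof. exact: sa_mul. Qed.

Local Notation zpow := (isometry_zpow s).

Let gamma1 : gamma 1%g = cone.
Proof. by apply: isometry_idem => //; rewrite -gammaM mulg1. Qed.

Let gammaV X : (gamma X)^# = gamma X^-1%g.
Proof.
rewrite -[RHS](isometryK _ (gamma_isometry X)) -gammaM mulgV gamma1.
by rewrite cmulr1.
Qed.

Let zpowV z : (zpow z)^# = zpow (- z).
Proof.
case: z => [[|n]|n]; rewrite /isometry_zpow.
- exact: adj1.
- by rewrite adj_cpow.
- by rewrite adj_cpow adjK.
Qed.

Let theta_gamma X a : gamma X ** theta a = theta (act (X, 0) a) ** gamma X.
Proof. by rewrite -gamma_theta -!cmulA gamma_isometry cmulr1. Qed.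

Let theta_s a : s ** theta a = theta (act (1%g, 1) a) ** s.
Proof. by rewrite -s_theta -!cmulA s_isometry cmulr1. Qed.

Let zpowS z a : theta a ** (s ** zpow z) = theta a ** zpow (1 + z).
Proof.
have act1K b : act (1%g, 1) (act (1%g, -1) b) = b.
  by rewrite -actM sdzM lim_phiz1 mulg1 addrN; exact: sa_one act_action b.
(* theta b is of the form s x s^*, as the action of the generator is invertible *)
have absorb b : theta b ** (s ** s^#) = theta b.
  by rewrite -{1}(act1K b) -s_theta -!cmulA isometryK// cmulA s_theta act1K.
case: z => [n|[|n]] //.
  by rewrite /isometry_zpow /= cmulr1 absorb cmulr1.
rewrite (_ : 1 + Negz n.+1 = Negz n); last by lia.
rewrite -[zpow (Negz n.+1)]/(s^# ** zpow (Negz n)).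
by rewrite (cmulA s) (cmulA _ (s ** _)) absorb.
Qed.

Let zpowP z : s^# ** zpow z = zpow (-1 + z).
Proof.
case: z => [[|n]|n].
- by rewrite addr0.
- by rewrite (_ : -1 + n.+1%:Z = n%:Z); [exact: isometryK|lia].
- by rewrite (_ : -1 + Negz n = Negz n.+1); [|lia].
Qed.

Let zpow_theta z a : zpow z ** theta a = theta (act (1%g, z) a) ** zpow z.
Proof.
have act1z w b : act (1%g, 1) (act (1%g, w) b) = act (1%g, 1 + w) b.
  by rewrite -actM sdzM lim_phiz1 mulg1.
elim/int_ind: z a => [|n IH|n IH] a.
- by rewrite cmul1 cmulr1 (sa_one act_action).
- rewrite -[zpow n.+1]/(s ** zpow n) -cmulA IH cmulA theta_s -cmulA.
  by rewrite act1z.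
- rewrite (_ : - n.+1%:Z = -1 - n%:Z); last by lia.
  rewrite -zpowP -cmulA IH !cmulA; congr (_ ** _).
  rewrite (_ : act _ a = act (1%g, 1) (act (1%g, - 1 - n%:Z) a)); last first.
    by rewrite act1z addNKr.
  by rewrite -s_theta cmulA cmulA s_isometry cmul1.
Qed.

Let zpow_gamma z X : zpow z ** gamma X = gamma (lim_phiz z X) ** zpow z.
Proof.
have sV Y : s^# ** gamma Y = gamma (lim_phiV Y) ** s^#.
  have := congr1 adj (s_gamma (lim_phiV Y)); rewrite !adjM lim_phiVK => sY.
  rewrite -[RHS]cmulr1 -(gamma_isometry Y) -cmulA (cmulA s^#) -sY !cmulA.
  by rewrite gammaV -gammaM mulgV gamma1 cmul1.
elim/int_ind: z X => [|n IH|n IH] X.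
- by rewrite cmul1 cmulr1.
- by rewrite -[zpow n.+1]/(s ** zpow n) -cmulA IH cmulA s_gamma -cmulA.
- rewrite (_ : - n.+1%:Z = -1 - n%:Z); last by lia.
  by rewrite lim_phizD -zpowP -cmulA IH cmulA sV -cmulA.
Qed.

Let zpowD z w a : theta a ** (zpow z ** zpow w) = theta a ** zpow (z + w).
Proof.
have act1K b : act (1%g, 1) (act (1%g, -1) b) = b.
  by rewrite -actM sdzM lim_phiz1 mulg1 addrN; exact: sa_one act_action b.
have actV1K b : act (1%g, -1) (act (1%g, 1) b) = b.
  by rewrite -actM sdzM lim_phiz1 mulg1 addNr; exact: sa_one act_action b.
have theta_sV b : s^# ** theta (act (1%g, 1) b) = theta b ** s^#.
  by rewrite -s_theta -!cmulA isometryK.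
elim/int_ind: z a => [|n IH|n IH] a.
- by rewrite cmul1 add0r.
- rewrite -[zpow n.+1]/(s ** zpow n) -addn1 PoszD (addrC n%:Z) -addrA -zpowS.
  by rewrite -{1 2}(act1K a) -!cmulA (cmulA (theta _)) -theta_s -cmulA IH cmulA theta_s cmulA.
- rewrite (_ : - n.+1%:Z = -1 - n%:Z); last by lia.
  rewrite -addrA -!zpowP -cmulA.
  by rewrite !(cmulA (theta a)) -theta_sV -!(cmulA s^#) IH.
Qed.

(** [theta a * s s^* = theta a] makes the isometry [s] act as a unitary on the
    range of [theta]; so although [g |-> gamma g.1 * zpow g.2] need not be
    multiplicative, its products with elements of the range are those of a
    covariant representation. *)
Lemma cpr_of_covariant :
  crossed_product_rep act (fun a g => theta a ** (gamma g.1 ** zpow g.2)).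
Proof.
have actK X b : act (X, 0) (act (X^-1%g, 0) b) = b.
  by rewrite -actM sdzM mulgV addr0; exact: sa_one act_action b.
have act_split X z b : act (X, z) b = act (X, 0) (act (1%g, z) b).
  by rewrite -actM sdzM mulg1 add0r.
split.
- by move=> g a x y /=; rewrite star_homL// cmulDl cmulZl.
- move=> a [X z] b [Y w] /=.
  rewrite gammaM (star_homM theta_hom) act_split -!cmulA; congr (_ ** _).
  rewrite (cmulA (zpow z)) zpow_theta -!cmulA (cmulA (gamma X)) theta_gamma.
  rewrite -!cmulA (cmulA (zpow z)) zpow_gamma -!cmulA !(cmulA (gamma X)) -gammaM.
  move: (X * _)%g (act (X, 0) _) => Z c.
  rewrite -(actK Z c) !(cmulA (theta _)) -theta_gamma -!cmulA.
  by congr (_ ** _); exact: zpowD.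
- move=> a [X z] /=; rewrite !adjM zpowV gammaV -(star_homV theta_hom).
  by rewrite zpow_gamma -cmulA zpow_theta cmulA theta_gamma -cmulA -act_split.
Qed.

End CrossedProductRep.

(** * The dilated crossed product and its corner *)

Section Dilation.
Context {R : realType} {G : groupType}.
Variable phi : {multiplicative G -> G}.
Hypothesis phi_inj : injective phi.
Local Notation S := (semidirect_nat phi).
Local Notation T := (semidirect_int phi).
Local Notation emb := (semidirect_emb phi).

Lemma lim_phizE n m h :
  lim_phiz (Posz n) (to_lim phi m h) = to_lim phi m (endo_pow phi n h).
Proof. by elim: n => //= n ->; rewrite lim_phiE. Qed.

Lemma semidirect_embM (p r : S) : emb (p * r)%g = (emb p * emb r)%g.
Proof.
case: p r => [g n] [h m].
by rewrite sdnM /semidirect_emb /= sdzM to_limM lim_phizE PoszD.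
Qed.

Lemma to_lim_inj m : injective (to_lim phi m).
Proof.
move=> g h /to_limP[k]; elim: (k + m)%N => // n IH.
by rewrite /endo_pow !iterS => /phi_inj.
Qed.

(** The [m]-th copy of [G] is the conjugate of [G] by the [m]-th power of the
    generator. *)
Lemma emb_conj m h :
  (emb (1%g, m) * ((to_lim phi m h, 0%R) : T) = emb (h, 0%N) * emb (1%g, m))%g.
Proof.
rewrite /semidirect_emb /= !sdzM; congr pair.
  rewrite lim_phizE -(to_limS phi 0 m h) addn0.
  by rewrite -(lim_oneE phi 0) mul1g /= mulg1.
by rewrite addr0 add0r.
Qed.

(** The coordinate of an element of the limit group in the [n]-th copy of
    [G]; the value [1] is taken as long as [n] is too small to have one. *)
Definition coord (n : nat) (X : group_lim phi) : G :=
  xget 1%g [set h | to_lim phi n h = X].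

Lemma coordE n m h : (m <= n)%N -> coord n (to_lim phi m h) = endo_pow phi (n - m) h.
Proof.
move=> mn; apply: xget_subset1.
  by rewrite /= -{1}(subnK mn) to_limS.
by move=> g1 g2 /= <- /to_lim_inj.
Qed.

Variables (D C : unitalCstarAlgType R) (alpha : S -> D -> D).
Variables (iD : D -> C) (iS : S -> C).
Hypothesis C_univ : is_semigroup_crossed_product alpha iD iS.
Hypothesis iD_iso : forall x, nr (iD x) = nr x.

Let cov := scp_covariant C_univ.
Let iD_hom : star_hom iD := sc_hom cov.
Let iso := sc_isometry cov.
Let iSM := sc_mul cov.

Lemma iD_injective : injective iD.
Proof. exact: isometric_injective. Qed.

Lemma alphaM p r x : alpha (p * r)%g x = alpha p (alpha r x).
Proof.
apply: iD_injective; rewrite -!(sc_covariance cov) iSM adjM.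
by rewrite !cmulA.
Qed.

Lemma alpha1 x : alpha 1%g x = x.
Proof.
apply: iD_injective; rewrite -(sc_covariance cov) (isorep1 iso iSM) adj1.
by rewrite cmul1 cmulr1.
Qed.

Lemma alpha_hom p : star_hom (alpha p).
Proof.
pose f := (fun c => iS p ** c ** (iS p)^#) \o iD.
have fh : star_hom f := star_hom_comp (conj_isometry_hom (iso p)) iD_hom.
have fE x : iD (alpha p x) = f x by rewrite -(sc_covariance cov).
split=> [a x y|x y|x]; apply: iD_injective.
- by rewrite (star_homL iD_hom) !fE (star_homL fh).
- by rewrite (star_homM iD_hom) !fE (star_homM fh).
- by rewrite (star_homV iD_hom) !fE (star_homV fh).
Qed.

Lemma nr_alpha p x : nr (alpha p x) = nr x.
Proof. by rewrite -iD_iso -(sc_covariance cov) nr_conj_isometry. Qed.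

(** ** The limit along the isometry, inside the asymptotic algebra *)

Let s := iS (1%g, 1%N).
Let s_iso : isometry s := iso _.
Local Notation M := (asymp C).

Definition push (n : nat) (c : C) : C := s ^^ n ** c ** (s ^^ n)^#.

Lemma push_hom n : star_hom (push n).
Proof. exact/conj_isometry_hom/isometry_cpow. Qed.

Lemma nr_push n c : nr (push n c) = nr c.
Proof. exact/nr_conj_isometry/isometry_cpow. Qed.

Lemma pushD n m c : push (n + m) c = push n (push m c).
Proof. by rewrite /push cpowD adjM !cmulA. Qed.

Lemma push1 c : push 1 c = s ** c ** s^#.
Proof. by rewrite /push cpow1. Qed.

Lemma push_iD n x : push n (iD x) = iD (alpha (1%g, n) x).
Proof. by rewrite -(sc_covariance cov) (isorepX iso iSM). Qed.

(** The element [c] of the [m]-th copy of [C] in the limit along [push 1]; its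
    image in the copy of index [n] is [push (n - m) c].  The terms with [n < m],
    where the truncated difference is [0], are irrelevant in the quotient. *)
Definition tail (m : nat) (c : C) : M := cls (fun n => push (n - m) c).

Lemma bounded_push m c : bounded_seq (fun n => push (n - m) c).
Proof. by exists (nr c) => n; rewrite nr_push. Qed.

Lemma tail_hom m : star_hom (tail m).
Proof.
have b := @bounded_push m; split=> [a x y|x y|x].
- rewrite /tail clsZ// clsD//; last exact: bounded_seqZ.
  by congr cls; apply/funext => n; rewrite (star_homL (push_hom _)).
- by rewrite /tail clsM//; congr cls; apply/funext => n; rewrite (star_homM (push_hom _)).
- by rewrite /tail clsV//; congr cls; apply/funext => n; rewrite (star_homV (push_hom _)).
Qed.

Lemma nr_tail m c : nr (tail m c) = nr c.
Proof. by apply: nr_cls_cst => n; rewrite nr_push. Qed.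

Lemma tail_push k m c : tail (k + m) (push k c) = tail m c.
Proof.
apply: cls_eventually; [exact: bounded_push|exact: bounded_push|].
exists (k + m)%N => n kmn; rewrite -pushD; congr (push _ c); lia.
Qed.

Lemma tail_conj m c :
  cls (fun _ => s) ** tail m c ** (cls (fun _ => s))^# = tail m (s ** c ** s^#).
Proof.
have b := bounded_push m; have bs := bounded_cst s.
rewrite /tail clsV// !clsM//; try by [exact: bounded_seqM|exact: bounded_cst].
by congr cls; apply/funext => n; rewrite -!push1 -!pushD addnC.
Qed.

(* an element of the limit group acts in the [n]-th copy of [C] through its
   coordinate in the [n]-th copy of [G] *)
Let gamma (X : group_lim phi) : M := cls (fun n => iS (coord n X, 0%N)).

Let bounded_iS (f : nat -> S) : bounded_seq (fun n => iS (f n)).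
Proof. by exists 1 => n; exact: nr_isometry. Qed.

Lemma coord_gammaM X Y : gamma (X * Y)%g = gamma X ** gamma Y.
Proof.
have [m [g [h [-> ->]]]] := to_lim2 X Y.
rewrite -to_limM /gamma clsM//; apply: cls_eventually => //.
  exact: bounded_seqM.
by exists m => n mn; rewrite !coordE// endo_powM -iSM sdnM.
Qed.

Lemma coord_gamma_isometry X : isometry (gamma X).
Proof.
rewrite /isometry /gamma clsV// clsM//; last exact: bounded_seqV.
by rewrite -cls1; congr cls; apply/funext => n; exact: iso.
Qed.

Lemma shift_isometry : isometry (cls (fun _ => s) : M).
Proof.
rewrite /isometry clsV ?clsM; do ?exact: bounded_cst.
by rewrite -cls1; congr cls; apply/funext => n; exact: s_iso.
Qed.

Lemma shift_gamma X :
  cls (fun _ => s) ** gamma X = gamma (lim_phi X) ** cls (fun _ => s).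
Proof.
have [m [h ->]] := to_lim_surj X; have bs := bounded_cst s.
rewrite lim_phiE /gamma !clsM//; apply: cls_eventually; try exact: bounded_seqM.
exists m => n mn; rewrite !coordE//.
have := isorep_comm iso iSM 1 (endo_pow phi (n - m) h); rewrite !cpow1 => ->.
by rewrite -endo_powD -[phi h]/(endo_pow phi 1 h) -endo_powD addnC.
Qed.

Lemma gamma_tail m h c :
  gamma (to_lim phi m h) ** tail m c ** (gamma (to_lim phi m h))^# =
  tail m (iS (h, 0%N) ** c ** (iS (h, 0%N))^#).
Proof.
have b := bounded_push m; rewrite /tail /gamma clsV// !clsM//; last first.
- exact: bounded_seqV.
- exact: bounded_seqM.
apply: cls_eventually => //.
  by apply: bounded_seqM; [exact: bounded_seqM|exact: bounded_seqV].
exists m => n mn; rewrite coordE// /push.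
have := isorep_comm iso iSM (n - m) h; rewrite -/s => E.
transitivity ((s ^^ (n - m) ** iS (h, 0%N)) ** c ** (s ^^ (n - m) ** iS (h, 0%N))^#).
  by rewrite E adjM !cmulA.
by rewrite adjM !cmulA.
Qed.

(** ** The dilated algebra *)

Variables (L : cstarAlgType R) (lam : S -> D -> L) (act : T -> L -> L).
Hypothesis dil : minimal_automorphic_dilation emb alpha lam act.
Let lim := mad_limit dil.
Let action := mad_action dil.
Let act_hom g : star_hom (act g) := sa_hom action g.
Let lam_hom p : star_hom (lam p) := il_hom lim p.
Let iota : D -> L := lam 1%g.

Lemma actM g h a : act (g * h)%g a = act g (act h a).
Proof. exact: (sa_mul action g h a). Qed.

Lemma actK g a : act g^-1%g (act g a) = a.
Proof. by rewrite -actM mulVg; exact: sa_one action a. Qed.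

Lemma actVK g a : act g (act g^-1%g a) = a.
Proof. by rewrite -actM mulgV; exact: sa_one action a. Qed.

Lemma act_iota p x : act (emb p) (iota x) = iota (alpha p x).
Proof. exact: mad_dilation dil p x. Qed.

Lemma nr_act g a : nr (act g a) = nr a.
Proof.
apply/eqP; rewrite eq_le star_hom_contractive//=.
by rewrite -{1}(actK g a) star_hom_contractive.
Qed.

(** The copy of [D] of index [p] in [L], placed there by the action. *)
Definition unshift (p : S) (x : D) : L := act (emb p)^-1%g (iota x).

Lemma unshift_hom p : star_hom (unshift p).
Proof. exact: (star_hom_comp (act_hom (emb p)^-1%g) (lam_hom 1%g)). Qed.

Lemma unshift_alpha p r x : unshift (r * p)%g (alpha r x) = unshift p x.
Proof. by rewrite /unshift semidirect_embM invgM actM -act_iota actK. Qed.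

Lemma unshift_lift k m x : unshift (1%g, (k + m)%N) (alpha (1%g, k) x) = unshift (1%g, m) x.
Proof.
rewrite -(unshift_alpha (1%g, m) (1%g, k)); congr (unshift (_, _) _).
by rewrite endo_pow1 mulg1.
Qed.

Lemma unshift_nat g m x : unshift (g, m) x = unshift (1%g, m) (alpha (g^-1%g, 0%N) x).
Proof.
rewrite -(unshift_alpha (g, m) (g^-1%g, 0%N)); congr (unshift (_, _) _).
by rewrite mulVg.
Qed.

(** Only the powers of the generating isometry matter in the limit: the
    elements [(g, m)] and [(1, m)] of [S] divide each other. *)
Lemma unshift_dense a (e : R) : 0 < e ->
  exists m x, nr (a - unshift (1%g, m) x) < e.
Proof.
move=> e0; have : closure (\bigcup_p (act (emb p)^-1%g @` range (lam 1%g))) a.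
  by rewrite (mad_minimal dil).
move=> /closure_nrP /(_ _ e0) [_ [[g m] _ [_ [x _ <-] <-]] ax].
by exists m, (alpha (g^-1%g, 0%N) x); rewrite -unshift_nat.
Qed.

Lemma unshift_closed (E : set L) : closed E ->
  (forall m x, E (unshift (1%g, m) x)) -> forall a, E a.
Proof.
move=> /closed_nrP cE EU a; apply: cE => e /(unshift_dense a)[m [x ax]].
by exists (unshift (1%g, m) x).
Qed.

Lemma unshift_ext (V : normedModType R[i]) (f g : L -> V) :
  lipschitz_map f -> lipschitz_map g ->
  (forall m x, f (unshift (1%g, m) x) = g (unshift (1%g, m) x)) -> f =1 g.
Proof. by move=> fl gl; exact: unshift_closed (closed_eq_lip fl gl). Qed.

(** The images of the [lam p] exhaust the limit, because a *-homomorphism into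
    the closed subalgebra that they form is provided by the universal property
    and has to be a section of its inclusion. *)
Lemma lam_dense : closure (\bigcup_p range (lam p)) = setT.
Proof.
set E0 := \bigcup_p range (lam p).
have lamN p x : exists y, lam p x = lam (1%g, p.2) y.
  case: p => g m; exists (alpha (g^-1%g, 0%N) x).
  rewrite -(il_compat lim (g, m) (g^-1%g, 0%N)); congr (lam (_, _) _).
  by rewrite mulVg.
have lamS k m x : lam (1%g, m) x = lam (1%g, (k + m)%N) (alpha (1%g, k) x).
  rewrite -(il_compat lim (1%g, m) (1%g, k)); congr (lam (_, _) _).
  by rewrite endo_pow1 mulg1.
have lam2 p r x y : exists m x' y', lam p x = lam (1%g, m) x' /\ lam r y = lam (1%g, m) y'.
  have [x1 ->] := lamN p x; have [y1 ->] := lamN r y.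
  exists (r.2 + p.2)%N, (alpha (1%g, r.2) x1), (alpha (1%g, p.2) y1).
  by split; [|rewrite addnC]; exact: lamS.
have cE : cstar_subalgebra (closure E0).
  apply: closure_cstar_subalgebra.
  - by exists 1%g => //; exists 0 => //; rewrite star_hom0.
  - move=> _ _ [p _ [x _ <-]] [r _ [y _ <-]].
    have [m [x' [y' [-> ->]]]] := lam2 p r x y.
    by exists (1%g, m) => //; exists (x' + y') => //; rewrite star_homD.
  - move=> a _ [p _ [x _ <-]].
    by exists p => //; exists (a *: x) => //; rewrite star_homZ.
  - move=> _ _ [p _ [x _ <-]] [r _ [y _ <-]].
    have [m [x' [y' [-> ->]]]] := lam2 p r x y.
    by exists (1%g, m) => //; exists (x' ** y') => //; rewrite star_homM.
  - move=> _ [p _ [x _ <-]].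
    by exists p => //; exists (x^#) => //; rewrite star_homV.
have lamE p x : closure E0 (lam p x).
  by apply: subset_closure; exists p => //; exists x.
have [r [[rh rlam] _]] := il_universal lim
  (fun p => subcorestr_hom cE (lam_hom p) (lamE p))
  (fun p q x => congr1 (subcorestr cE) (il_compat lim p q x)).
have [k [_ kP]] := il_universal lim lam_hom (il_compat lim).
have vr : (@subval R L _ cE) \o r = id.
  rewrite -(kP (_ \o r)); last first.
    split=> [|p x /=]; first exact: star_hom_comp (subval_hom cE) rh.
    by rewrite rlam /= subcorestrK.
  by rewrite -(kP id)//; split.
apply/seteqP; split=> // y _; rewrite -[y]/(id y) -vr.
exact: subvalP.
Qed.

(** The copy of index [(g, m)] is sent to the copy of index [m] after the
    translation by [g^-1], as [(1, m)] is the product of [(g^-1, 0)] and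
    [(g, m)]. *)
Lemma limit_to_asymp : exists2 th : L -> M, star_hom th &
  forall p x, th (lam p x) = tail p.2 (iD (alpha (p.1^-1%g, 0%N) x)).
Proof.
pose lamM (p : S) (x : D) : M := tail p.2 (iD (alpha (p.1^-1%g, 0%N) x)).
have lamM_hom r : star_hom (lamM r).
  exact: star_hom_comp (tail_hom _) (star_hom_comp iD_hom (alpha_hom _)).
have lamM_compat r t y : lamM (t * r)%g (alpha t y) = lamM r y.
  case: t r => [h k] [g m]; rewrite /lamM sdnM /= -(tail_push k m) push_iD.
  rewrite -!alphaM !sdnM; congr (tail _ (iD (alpha (_, _) _))) => //; last by rewrite addn0.
  by rewrite /= mul1g invgM -mulgA mulVg mulg1 endo_powV.
have [th [[thh thlam] _]] := il_universal lim lamM_hom lamM_compat.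
by exists th.
Qed.

Lemma nr_lam p x : nr (lam p x) = nr x.
Proof.
have [th thh thlam] := limit_to_asymp.
apply/eqP; rewrite eq_le star_hom_contractive//=.
rewrite (le_trans _ (star_hom_contractive thh _))// thlam.
by rewrite nr_tail iD_iso nr_alpha.
Qed.

(** The maps [unshift p] present [L] as the same inductive limit as the [lam p],
    but [lam p] and [unshift p] can differ off the range of [alpha p]; the
    resulting endomorphism of [L] is isometric with dense range. *)
Lemma unshift_iso : exists kappa' : L -> L,
  star_hom kappa' /\ forall p x, kappa' (unshift p x) = lam p x.
Proof.
have [kappa [[kh klam] _]] := il_universal lim unshift_hom
  (fun p q x => unshift_alpha p q x).
have ki x : nr (kappa x) = nr x.
  have cE := closed_nr_eq (lipschitz_star_hom kh).
  have : closure [set a | nr (kappa a) = nr a] x.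
    have : closure (\bigcup_p range (lam p)) x by rewrite lam_dense.
    apply: closureS => _ [p _ [y _ <-]] /=.
    by rewrite klam /unshift nr_act !nr_lam.
  by move=> /cE.
have ksurj y : exists x, kappa x = y.
  have [m x|x _ xy] := unshift_closed (closed_range_isometric kh ki) _ y.
    by exists (lam (1%g, m) x) => //; exact: klam.
  by exists x.
have /choice[kinv kK] := ksurj.
have kinj := isometric_injective kh ki.
exists kinv; split; first exact: inv_star_hom kh kinj kK.
by move=> p x; apply: kinj; rewrite kK klam.
Qed.

Lemma asymp_representation : exists2 theta : L -> M, star_hom theta &
  forall m x, theta (unshift (1%g, m) x) = tail m (iD x).
Proof.
have [th thh thlam] := limit_to_asymp; have [k [kh kU]] := unshift_iso.
exists (th \o k); first exact: star_hom_comp.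
by move=> m x; rewrite /= kU thlam /= invg1 (alpha1 x).
Qed.

Section Representation.
Variable theta : L -> M.
Hypothesis theta_hom : star_hom theta.
Hypothesis theta_unshift : forall m x, theta (unshift (1%g, m) x) = tail m (iD x).
Let shat : M := cls (fun _ => s).

Let lip_conj (c d : M) (f : L -> M) :
  lipschitz_map f -> lipschitz_map (fun a => c ** f a ** d).
Proof.
move=> fl; have := lipschitz_comp (lipschitz_cmull c) fl.
by move=> /(lipschitz_comp (lipschitz_cmulr d)).
Qed.

Let theta_lip := lipschitz_star_hom theta_hom.

Let theta_act_lip g : lipschitz_map (fun a => theta (act g a)).
Proof. exact: lipschitz_star_hom (star_hom_comp theta_hom (act_hom g)). Qed.

Lemma shift_theta a : shat ** theta a ** shat^# = theta (act (1%g, 1) a).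
Proof.
move: a; apply: unshift_ext => [||m x]; [exact: lip_conj|exact: theta_act_lip|].
rewrite theta_unshift tail_conj (sc_covariance cov) -theta_unshift; congr theta.
rewrite /unshift -act_iota -!actM; congr act.
apply: (mulgI (emb (1%g, m))); rewrite mulgA mulgV mul1g mulgA.
rewrite -[(1%g, 1) : T]/(emb (1%g, 1%N)) -semidirect_embM.
have -> : (((1%g, m) : S) * ((1%g, 1%N) : S))%g = (((1%g, 1%N) : S) * ((1%g, m) : S))%g.
  by rewrite !sdnM !endo_pow1 addnC.
by rewrite semidirect_embM -mulgA mulgV mulg1.
Qed.

Lemma gamma_theta X a : gamma X ** theta a ** (gamma X)^# = theta (act (X, 0) a).
Proof.
move: a; apply: unshift_ext => [||m x]; [exact: lip_conj|exact: theta_act_lip|].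
have [k [h ->]] := to_lim_surj X.
rewrite -(to_limS phi k m h) -(unshift_lift k m) (addnC k m).
move: (m + k)%N (endo_pow phi m h) (alpha _ x) => n g y.
rewrite theta_unshift gamma_tail (sc_covariance cov) -theta_unshift; congr theta.
rewrite /unshift -act_iota -!actM; congr act.
apply: (mulgI (emb (1%g, n))); rewrite mulgA mulgV mul1g mulgA emb_conj.
by rewrite -mulgA mulgV mulg1.
Qed.

Lemma asymp_cpr : crossed_product_rep act
  (fun a g => theta a ** (gamma g.1 ** isometry_zpow shat g.2)).
Proof.
apply: cpr_of_covariant => //.
- exact: coord_gamma_isometry.
- exact: coord_gammaM.
- exact: shift_isometry.
- exact: shift_gamma.
- exact: gamma_theta.
- exact: shift_theta.
Qed.

(** The value of the representation on [q u_p], the image of [iS p] in the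
    crossed product, is the sequence of the [s^n (iS p) s^*n]. *)
Lemma asymp_cpr_iS p :
  theta (iota (alpha p cone)) **
    (gamma (emb p).1 ** isometry_zpow shat (emb p).2) = tail 0 (iS p).
Proof.
case: p => g m; have -> y : iota y = unshift (1%g, 0%N) y.
  by rewrite /unshift -{1}(actK 1%g (iota y)) (sa_one action (iota y)).
rewrite theta_unshift -(sc_covariance cov) (sc_unital cov) cmulr1 /=.
have shatX : shat ^^ m = cls (fun _ => s ^^ m).
  elim: m => [|m IH] //=; rewrite IH clsM//; exact: bounded_cst.
rewrite shatX /gamma /tail; have bs := bounded_cst (s ^^ m).
rewrite !clsM//; [|exact: bounded_push|exact: bounded_seqM].
congr cls; apply/funext => n; rewrite subn0 coordE// subn0.
set v := iS (g, m); have vE : v = iS (g, 0%N) ** s ^^ m := isorepE iso iSM g m.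
have E : s ^^ n ** v = iS (endo_pow phi n g, 0%N) ** s ^^ m ** s ^^ n.
  rewrite vE cmulA (isorep_comm iso iSM) -!cmulA; congr (_ ** _).
  by rewrite -!cpowD addnC.
set w := iS (endo_pow phi n g, 0%N) ** s ^^ m in E *.
have wi : isometry w by apply: isometry_mul => //; exact: isometry_cpow.
rewrite /push -!cmulA; congr (_ ** (_ ** _)).
by rewrite !cmulA -adjM E adjM -!cmulA wi cmulr1.
Qed.

End Representation.

(** ** The corner of the crossed product *)

Variables (P : cstarAlgType R) (j : L -> T -> P).
Hypothesis P_univ : is_group_crossed_product act j.
Let jrep := gcp_rep P_univ.
Let jM a g b h : j a g ** j b h = j (a ** act g b) (g * h)%g := cpr_mul jrep a g b h.
Let jV a g : (j a g)^# = j (act g^-1%g a^#) g^-1%g := cpr_adj jrep a g.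
Let q := j (iota cone) 1%g.

Let act1 a : act 1%g a = a.
Proof. exact: (sa_one action a). Qed.

Let iotaM x y : iota (x ** y) = iota x ** iota y.
Proof. exact: (star_homM (lam_hom _)). Qed.

Let j1M a b : j a 1%g ** j b 1%g = j (a ** b) 1%g.
Proof. by rewrite jM act1 mulg1. Qed.

Let j1V a : (j a 1%g)^# = j a^# 1%g.
Proof. by rewrite jV invg1 act1. Qed.

Lemma j1_hom : star_hom (fun a => j a 1%g).
Proof.
by split=> [|a b|a]; [exact: cpr_linear jrep 1%g|rewrite j1M|rewrite j1V].
Qed.

(** [(j a g) (j a g)^* = j (a a^* ) 1] reduces the norm of [j a g] to that of
    the value at [a a^*] of a *-homomorphism. *)
Lemma lipschitz_j g : lipschitz_map (j^~ g).
Proof.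
exists 1 => // a b.
have -> : j a g - j b g = j (a - b) g.
  have jl := cpr_linear jrep g; rewrite -scaleN1r addrC -jl.
  by rewrite scaleN1r addrC.
rewrite mul1r -ler_sqr ?nnegrE ?nr_ge0// -!nr_mulM jV jM mulgV actVK.
exact: star_hom_contractive j1_hom _.
Qed.

Lemma q_projection : projection q.
Proof.
have q1 : (cone : D)^# = cone := adj1 D.
split; first by rewrite j1M -iotaM cmul1.
by rewrite j1V -(star_homV (lam_hom _)) q1.
Qed.

(* [u_p q], with the coefficient moved to the left of the unitary *)
Let v (p : S) : P := j (iota (alpha p cone)) (emb p).

Let alphaD p : alpha p cone ** alpha p cone = alpha p cone.
Proof. by rewrite -(star_homM (alpha_hom p)) cmul1. Qed.

Let alphaV p : (alpha p cone)^# = alpha p cone.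
Proof. by rewrite -(star_homV (alpha_hom p)) adj1. Qed.

Let iotaV x : iota x^# = (iota x)^#.
Proof. exact: (star_homV (lam_hom _)). Qed.

Let vV p : (v p)^# = j (iota cone) (emb p)^-1%g.
Proof. by rewrite jV -iotaV alphaV -act_iota actK. Qed.

Let v_q p : v p ** q = v p.
Proof. by rewrite jM mulg1 act_iota -iotaM alphaD. Qed.

Let q_v p : q ** v p = v p.
Proof. by rewrite jM mul1g act1 -iotaM cmul1. Qed.

Let v_isometry p : (v p)^# ** v p = q.
Proof. by rewrite vV jM mulVg -act_iota actK -iotaM cmul1. Qed.

Let vM p r : v (p * r)%g = v p ** v r.
Proof.
rewrite jM -semidirect_embM act_iota -iotaM -alphaM; congr (j (iota _) _).
by rewrite alphaM -(star_homM (alpha_hom p)) cmul1.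
Qed.

Let v_covariance p x : v p ** j (iota x) 1%g ** (v p)^# = j (iota (alpha p x)) 1%g.
Proof.
rewrite vV !jM mulg1 mulgV !act_iota -!iotaM; congr (j (iota _) _).
by rewrite -!(star_homM (alpha_hom p)) cmulr1 cmul1.
Qed.

Local Notation K := (corner_alg q_projection).
Let val_hom : star_hom (@usubval R P _ (corner_subalgebra q_projection) (corner_unit q_projection)) :=
  usubval_hom _ _.

Let corner_iota x : corner q (j (iota x) 1%g).
Proof.
by apply: (corner_mem q_projection); rewrite j1M -iotaM ?cmul1 ?cmulr1.
Qed.

Let corner_v p : corner q (v p).
Proof. by apply: (corner_mem q_projection); [exact: q_v|exact: v_q]. Qed.

Lemma corner_covariant : semigroup_covariant alpha
  (fun x => usubcorestr _ _ (j (iota x) 1%g) : K)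
  (fun p => usubcorestr _ _ (v p) : K).
Proof.
have cv := corner_v; have ci := corner_iota.
split=> [||p|p r|p x].
- exact: (subcorestr_hom (corner_subalgebra q_projection)
    (star_hom_comp j1_hom (lam_hom 1%g)) corner_iota).
- by apply: usubval_inj; rewrite usubcorestrK// usubval1.
- apply: usubval_inj; rewrite usubval1 (star_homM val_hom) (star_homV val_hom).
  by rewrite usubcorestrK// v_isometry.
- by apply: usubval_inj; rewrite (star_homM val_hom) !usubcorestrK// vM.
- apply: usubval_inj; rewrite !(star_homM val_hom) (star_homV val_hom).
  by rewrite !usubcorestrK// v_covariance.
Qed.

Lemma crossed_product_to_corner : exists2 Psi : C -> P, star_hom Psi &
  [/\ forall x, Psi (iD x) = j (iota x) 1%g, forall p, Psi (iS p) = v p &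
      forall c, corner q (Psi c)].
Proof.
have [f [[fh fD fS] _]] := scp_universal C_univ corner_covariant.
exists (@usubval R P _ _ _ \o f); first exact: star_hom_comp val_hom fh.
split=> [x|p|c] /=.
- by rewrite fD usubcorestrK//; exact: corner_iota.
- by rewrite fS usubcorestrK//; exact: corner_v.
- exact: usubvalP.
Qed.

(** The representation of the crossed product in the asymptotic algebra maps
    [Psi c] to the sequence of the [s^n c s^*n], which has constant norm. *)
Lemma Psi_isometric (Psi : C -> P) : star_hom Psi ->
  (forall x, Psi (iD x) = j (iota x) 1%g) -> (forall p, Psi (iS p) = v p) ->
  forall c, nr (Psi c) = nr c.
Proof.
move=> Psi_hom PsiD PsiS.
have [theta theta_hom theta_unshift] := asymp_representation.
have [Th [[Th_hom Thj] _]] := gcp_universal P_univ (asymp_cpr theta_hom theta_unshift).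
have ThPsi : Th \o Psi =1 tail 0.
  apply: (star_hom_eq_generated (scp_generated C_univ)).
  - exact: star_hom_comp.
  - exact: tail_hom.
  - move=> _ [[x _ <-]|[p _ <-]] /=; last first.
      by rewrite PsiS Thj; exact: asymp_cpr_iS.
    rewrite PsiD Thj -(theta_unshift 0%N x) /= cmulr1.
    have -> : gamma 1%g = cone.
      apply: isometry_idem; first exact: coord_gamma_isometry.
      by rewrite -coord_gammaM mulg1.
    by rewrite cmulr1 /unshift -{1}(actK 1%g (iota x)) act1.
move=> c; apply/eqP; rewrite eq_le star_hom_contractive//=.
rewrite -(nr_tail 0 c) -ThPsi; exact: (star_hom_contractive Th_hom (Psi c)).
Qed.

(** The image of the finitely supported functions.  Closing off under sums is
    enough, because [j] is linear in its first argument and the [j a g] are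
    stable under products and adjoints. *)
Inductive finite_support : P -> Prop :=
| finite_support0 : finite_support 0
| finite_supportD a g y : finite_support y -> finite_support (j a g + y).

Lemma finite_support_dense : closure finite_support = setT.
Proof.
have fD x y : finite_support x -> finite_support y -> finite_support (x + y).
  move=> fx fy; elim: fx => [|a g x' _ IH]; first by rewrite add0r.
  by rewrite -addrA; constructor.
have fj a g : finite_support (j a g).
  by rewrite -[j a g]addr0; do 2 constructor.
have jZ a g (c : R[i]) : c *: j a g = j (c *: a) g.
  have jl := cpr_linear jrep g; have j0 : j 0 g = 0.
    by have := jl (-1) 0 0; rewrite scaler0 addr0 scaleN1r addNr.
  by rewrite -[c *: a]addr0 jl j0 addr0.
have cl : cstar_subalgebra (closure finite_support).
  apply: closure_cstar_subalgebra => //.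
  - exact: finite_support0.
  - move=> c x; elim=> [|a g y _ IH]; first by rewrite scaler0; constructor.
    by rewrite scalerDr jZ; constructor.
  - move=> x y fx fy; elim: fx => [|a g x' _ IH].
      by rewrite cmul0l; constructor.
    rewrite cmulDl; apply: fD => //.
    elim: fy {IH} => [|b h y' _ IH]; first by rewrite cmul0r; constructor.
    by rewrite cmulDr jM; constructor.
  - move=> x; elim=> [|a g y _ IH]; first by rewrite adj0; constructor.
    by rewrite adjD jV; constructor.
apply/seteqP; split=> // y _.
have : [set: P] y by []. rewrite -(gcp_generated P_univ) => gy.
apply: cstar_generated_min cl _ _ gy => _ [a _ [g _ <-]].
exact/subset_closure/fj.
Qed.

(** Every large power of the generator is a possible denominator, so that the
    denominator of [g] can be matched with the index of a copy of [D]. *)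
Lemma semidirect_int_frac (g : T) : exists k, forall m, exists r : S,
  g = ((emb (1%g, (k + m)%N))^-1 * emb r)%g.
Proof.
case: g => X z; have [k0 [h0 ->]] := to_lim_surj X.
exists (`|z| + k0)%N => m; set n := (_ + _ + m)%N.
have [r rz] : exists r : nat, n%:Z + z = r by exists (absz (n%:Z + z)); rewrite /n; lia.
exists (endo_pow phi (n - k0) h0, r).
apply: (mulgI (emb (1%g, n))); rewrite mulgA mulgV mul1g.
rewrite /semidirect_emb /= sdzM rz -(lim_oneE phi 0) mul1g; congr pair.
have -> : to_lim phi k0 h0 = to_lim phi n (endo_pow phi (n - k0) h0).
  by rewrite -{1}(@subnK k0 n) ?to_limS// /n; lia.
by rewrite lim_phizE -(to_limS phi 0 n) addn0.
Qed.

(** The compression of the generator [j a g] to the corner is, for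
    [g = p^-1 r] and [a = unshift p x], the element [(v p)^* (iota x) (v r)] of
    the range.  Since the compression is not multiplicative, this is extended
    from the [j a g] along sums and limits, not from generators of [P]. *)
Lemma corner_in_range (Psi : C -> P) : star_hom Psi ->
  (forall x, Psi (iD x) = j (iota x) 1%g) -> (forall p, Psi (iS p) = v p) ->
  closed (range Psi) -> corner q `<=` range Psi.
Proof.
move=> Psi_hom PsiD PsiS cPsi _ [y _ <-].
have lq : lipschitz_map (fun y => q ** y ** q).
  exact: lipschitz_comp (lipschitz_cmulr q) (lipschitz_cmull q).
have gen a g : range Psi (q ** j a g ** q).
  have [k kP] := semidirect_int_frac g; move: a; apply: unshift_closed.
    apply: closed_preim_lip (cPsi).
    exact: lipschitz_comp lq (lipschitz_j g).
  move=> m x; rewrite -(unshift_lift k); move: (alpha _ x) => x'.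
  have [r gE] := kP m; set p : S := (1%g, (k + m)%N) in gE *.
  exists ((iS p)^# ** iD x' ** iS r) => //.
  rewrite !(star_homM Psi_hom) (star_homV Psi_hom) PsiD !PsiS vV !jM.
  rewrite !mulg1 !mul1g act1 -gE; congr (j (_ ** _) g).
  by rewrite gE actM act_iota.
have sub : closure finite_support `<=` [set y | range Psi (q ** y ** q)].
  have cl : closed ((fun y => q ** y ** q) @^-1` range Psi).
    exact: closed_preim_lip lq cPsi.
  move=> z zf; apply: cl; apply: closureS zf => z'.
  elim=> [|a g y' _ [c _ cE]] /=.
    by exists 0 => //; rewrite (star_hom0 Psi_hom) cmul0r cmul0l.
  have [d _ dE] := gen a g.
  by exists (d + c) => //; rewrite (star_homD Psi_hom) dE cE cmulDr cmulDl.
by apply: sub; rewrite finite_support_dense.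
Qed.

Theorem crossed_product_iso_corner : exists Psi : C -> P, star_iso_onto Psi (corner q).
Proof.
have [Psi Psi_hom [PsiD PsiS Psi_corner]] := crossed_product_to_corner.
have Psi_iso := Psi_isometric Psi_hom PsiD PsiS.
exists Psi; split=> //; split.
- by move=> c _; exact: Psi_corner.
- by move=> c d _ _; exact: isometric_injective Psi_hom Psi_iso c d.
- move=> y yq; have cl := closed_range_isometric Psi_hom Psi_iso.
  by have [c _ cy] := corner_in_range Psi_hom PsiD PsiS cl yq; exists c.
Qed.

End Dilation.

Local Open Scope cstar_scope.

Theorem lemma3p5 (R : realType)
  (G : groupType) (countable_G : countable [set: G])
  (phi : {multiplicative G -> G}) (phi_inj : injective phi)
  (phi_coker : infinite_set (left_cosets (range phi)))
  (B : set (set G)) (B_subgroup : forall H, B H -> subgroup H)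
  (B_setT : B [set: G])
  (* U[phi, B] *)
  (U : unitalCstarAlgType R) (e : set G -> U) (u : G -> U) (s : U)
  (U_univ : is_UB phi B e u s)
  (* D[phi, B], with its inclusion in U[phi, B] *)
  (D : unitalCstarAlgType R) (incl : D -> U)
  (D_incl : star_iso_onto incl (DB B e u s))
  (* the action of S = G ><| N on D[phi, B] *)
  (alpha : semidirect_nat phi -> D -> D)
  (alphaE : forall g n x,
     incl (alpha (g, n) x) = u g * s ^+ n * incl x * s^* ^+ n * u (g^-1)%g)
  (* the crossed product of D[phi, B] by S *)
  (C : unitalCstarAlgType R) (iD : D -> C) (iS : semidirect_nat phi -> C)
  (C_univ : is_semigroup_crossed_product alpha iD iS)
  (* the minimal automorphic dilation, with lam (e, 0) = iota *)
  (Dbar : cstarAlgType R) (lam : semidirect_nat phi -> D -> Dbar)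
  (alphabar : semidirect_int phi -> Dbar -> Dbar)
  (dilation : minimal_automorphic_dilation
     (semidirect_emb phi) alpha lam alphabar)
  (* the full group crossed product of Dbar by Sbar *)
  (P : cstarAlgType R) (j : Dbar -> semidirect_int phi -> P)
  (P_univ : is_group_crossed_product alphabar j) :
  exists (Phi : U -> C) (Psi : C -> P),
    star_iso_onto Phi [set: C] /\
    star_iso_onto Psi (corner (j (lam 1%g 1) 1%g)).
Proof.
have [Phi Phi_iso _] := UB_iso_crossed_product B_setT U_univ D_incl alphaE C_univ.
have iD_iso := iD_isometric B_setT U_univ D_incl alphaE C_univ.
have [Psi Psi_iso] := crossed_product_iso_corner phi_inj C_univ iD_iso dilation P_univ.
by exists Phi, Psi.
Qed.
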